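(* Let $\Gamma\subset PGL_{2n+2}(\mathbb{C})$ be a group of type $\mathcal{L}$ and suppose the homogeneous coordinates $[z':z'']$ are such that there is $R>0$ with $V_R\subset\Omega(\Gamma)$ and $g(V_R)\cap V_R=\emptyset$ for every $g\in\Gamma\setminus\{1\}$. Assume $\Gamma$ is torsion free and satisfies both conditions $(\clubsuit)$ and $(\spadesuit)$. Write $\Omega=\Omega(\Gamma)$. Then: (1) for $g\in\Gamma$, $g(F)\subset F$ holds if and only if $g=1$; (2) for $g\in\Gamma\setminus\{1\}$, $g(F)\cap F=\emptyset$; (3) for every $z\in\Omega$ there is $g\in\Gamma$ with $g(z)\in\Omega\cap\bar F$; (4) if $w=g(z)$ for some $z,w\in\Omega\cap\bar F$ and $g\in\Gamma\setminus\{1\}$, then both $z$ and $w$ lie in $\Omega\cap\partial\bar F$.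
   Context: $z'=(z^0,\dots,z^n)$, $z''=(z^{n+1},\dots,z^{2n+1})$; $V_R=\{[z':z'']:\|z'\|>R\|z''\|\}$; $\|\cdot\|$ is the Euclidean norm and the operator norm. Each $g\in\Gamma\setminus\{1\}$ has a representative $\begin{pmatrix}A_g&B_g\\C_g&D_g\end{pmatrix}\in SL_{2n+2}(\mathbb{C})$ with $(n+1)\times(n+1)$ blocks, and $C_g$ is invertible under the hypothesis. $\bar\Delta_g=\{[z':z'']:\|z''\|\le\|C_gz'+D_gz''\|\}$, $\bar\Delta=\bigcap_{g\neq1}\bar\Delta_g$, $F=\operatorname{Int}\bar\Delta$ (the $F$-region), $\bar F$ its closure in $\mathbb{P}^{2n+1}$, $\partial\bar F=\bar F\setminus F$. With $\mathcal{R}=\{\|C_g^{-1}\|:g\in\Gamma\setminus\{1\}\}$: $(\clubsuit)$ means $\mathcal{R}$ is bounded; $(\spadesuit)$ means $\mathcal{R}$ has no accumulation point in $\mathbb{R}$ other than $0$. Type $\mathcal{L}$: an $n$-plane is an $n$-dimensional projective linear subspace of $\mathbb{P}^{2n+1}$; $\mathcal{G}\subset\mathbb{P}(\Lambda^{n+1}\mathbb{C}^{2n+2})$ is the Plücker-embedded Grassmannian, $\hat\ell$ the Plücker point of $\ell$, $\hat\sigma$ the induced action; the limit image of a sequence of distinct projective transformations whose representatives, normalized so the largest entry has absolute value $1$, converge to $T$ is $\mathbb{P}(\operatorname{Im}T)$; a sequence in discrete $\Gamma$ is normal if of distinct elements and both it and $(\hat\sigma_\nu)$ have convergent normalized representatives;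 limit $n$-planes are those $\ell$ with $\hat\ell$ in the limit image of some $(\hat\sigma_\nu)$, $(\sigma_\nu)$ normal; $\Omega(\Gamma)$ is the complement of their union; $\Gamma$ is of type $\mathcal{L}$ if discrete and $\Omega(\Gamma)$ contains a domain containing an $n$-plane. *)

(* Defs.v *)
(* complex numbers C := R[i] (mathcomp-real-closed) over an
   abstract R : realType (mathcomp-analysis reals, for `sup`).
   Points of P^{2n+1} are represented by nonzero column vectors of C^{2n+2};
   subsets of P^{2n+1} are represented by cones (sets of nonzero vectors
   invariant under nonzero scaling).  Elements of PGL are represented by
   invertible matrices; a subgroup of PGL by its full preimage in GL. *)
From HB Require Import structures.
From mathcomp Require Import all_boot all_order all_algebra.
From mathcomp Require Import complex.
From mathcomp Require Import classical_sets reals.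
Set Implicit Arguments. Unset Strict Implicit. Unset Printing Implicit Defensive.
Import Order.TTheory GRing.Theory Num.Theory.
Local Open Scope ring_scope.
Local Open Scope classical_set_scope.

Section Defs.
Variable R : realType.
Local Notation C := (R[i]).

Definition cabs (z : C) : R :=
  Num.sqrt (complex.Re z ^+ 2 + complex.Im z ^+ 2).

Definition vnorm m (v : 'cV[C]_m) : R :=
  Num.sqrt (\sum_(i < m) cabs (v i 0) ^+ 2).

Definition opnorm m (A : 'M[C]_m) : R :=
  sup [set vnorm (A *m v) | v in [set v : 'cV[C]_m | vnorm v = 1]].

Variable n : nat.
(* N = 2n+2, split as (n+1) + (n+1) so that block decompositions typecheck *)
Local Notation N := (n.+1 + n.+1)%N.
Local Notation vec := 'cV[C]_N.
Local Notation mat := 'M[C]_N.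

Definition pt_open (S : set vec) : Prop :=
  forall z, S z -> exists2 e : R, 0 < e &
    forall y : vec, y != 0 -> vnorm (y - z) < e -> S y.

Definition pt_interior (S : set vec) : set vec :=
  [set z | z != 0 /\ exists2 e : R, 0 < e &
     forall y : vec, vnorm (y - z) < e -> S y].

Definition pt_closure (S : set vec) : set vec :=
  [set z | z != 0 /\ forall e : R, 0 < e ->
     exists y : vec, S y /\ vnorm (y - z) < e].

Definition pt_connected (S : set vec) : Prop :=
  ~ exists O1 O2 : set vec,
      pt_open O1 /\ pt_open O2 /\ S `<=` O1 `|` O2 /\
      (S `&` O1 `&` O2 = set0) /\ (S `&` O1 !=set0) /\ (S `&` O2 !=set0).

Definition pt_domain (S : set vec) : Prop :=
  [/\ S !=set0, S `<=` [set z | z != 0], pt_open S & pt_connected S].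

Definition pt_image (g : mat) (S : set vec) : set vec :=
  [set g *m z | z in S].

(* g represents the identity of PGL *)
Definition is_scalar (g : mat) : Prop := exists a : C, g = a%:M.

Definition proj_eq (g h : mat) : Prop := exists a : C, a != 0 /\ g = a *: h.

(* Gamma is (the full preimage in GL_N(C) of) a subgroup of PGL_N(C) *)
Definition pgl_subgroup (G : set mat) : Prop :=
  [/\ forall g, G g -> g \in unitmx,
      G 1%:M,
      forall g h, G g -> G h -> G (g *m h),
      forall g, G g -> G (invmx g) &
      forall g (a : C), G g -> a != 0 -> G (a *: g)].

(* discreteness in the quotient topology of PGL *)
Definition pgl_discrete (G : set mat) : Prop :=
  forall g, G g -> exists2 e : R, 0 < e &
    forall h (a : C), G h -> a != 0 ->
      (forall i j, cabs ((a *: h) i j - g i j) < e) -> proj_eq h g.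

Definition torsion_free (G : set mat) : Prop :=
  forall g k, G g -> (0 < k)%N -> is_scalar (g ^+ k) -> is_scalar g.

Definition normalized (I J : finType) (M : I -> J -> C) : Prop :=
  (forall i j, cabs (M i j) <= 1) /\ exists i j, cabs (M i j) = 1.

Definition nconv (I J : finType) (s : nat -> I -> J -> C) (T : I -> J -> C)
  : Prop :=
  exists lam : nat -> C,
    (forall k, lam k != 0 /\ normalized (fun i j => lam k * s k i j)) /\
    forall e : R, 0 < e -> exists k0, forall k, (k0 <= k)%N ->
      forall i j, cabs (lam k * s k i j - T i j) < e.

(* index set of Lambda^{n+1} C^N : (n+1)-subsets of 'I_N *)
Definition pidx := {I : {set 'I_N} | #|I| == n.+1}.

Definition pdef : 'I_N := lshift n.+1 (@ord0 n).

Definition pel (I : pidx) (k : 'I_n.+1) : 'I_N := nth pdef (enum (val I)) k.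

(* an n-plane is P(W), W the column space of a rank n+1 matrix A *)
Definition nplane (A : 'M[C]_(N, n.+1)) : Prop := \rank A = n.+1.

Definition nplane_pts (A : 'M[C]_(N, n.+1)) : set vec :=
  [set z | z != 0 /\ exists c : 'cV[C]_n.+1, z = A *m c].

Definition plucker (A : 'M[C]_(N, n.+1)) (I : pidx) : C :=
  \det (\matrix_(i < n.+1, j < n.+1) A (pel I i) j).

(* the induced action on Lambda^{n+1} C^N: the (n+1)-th compound matrix *)
Definition compound (g : mat) (I J : pidx) : C :=
  \det (\matrix_(i < n.+1, j < n.+1) g (pel I i) (pel J j)).

Definition normal_seq (G : set mat) (s : nat -> mat)
    (T : 'I_N -> 'I_N -> C) (Th : pidx -> pidx -> C) : Prop :=
  [/\ forall k, G (s k),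
      forall k l, k <> l -> ~ proj_eq (s k) (s l),
      nconv (fun k i j => s k i j) T &
      nconv (fun k => compound (s k)) Th].

(* limit n-planes: the Plucker point lies in the limit image P(Im Th) *)
Definition limit_nplane (G : set mat) (A : 'M[C]_(N, n.+1)) : Prop :=
  nplane A /\
  exists (s : nat -> mat) T Th, normal_seq G s T Th /\
    exists v : pidx -> C, forall I, plucker A I = \sum_J Th I J * v J.

Definition Omega (G : set mat) : set vec :=
  [set z | z != 0 /\ ~ exists A, limit_nplane G A /\ nplane_pts A z].

Definition type_L (G : set mat) : Prop :=
  pgl_subgroup G /\ pgl_discrete G /\
  exists U : set vec, pt_domain U /\ U `<=` Omega G /\
    exists A, nplane A /\ nplane_pts A `<=` U.

Definition zp (z : vec) : 'cV[C]_n.+1 := usubmx z.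
Definition zpp (z : vec) : 'cV[C]_n.+1 := dsubmx z.

Definition V_R (r : R) : set vec :=
  [set z | z != 0 /\ vnorm (zp z) > r * vnorm (zpp z)].

Definition nontriv_SL (G : set mat) (g : mat) : Prop :=
  [/\ G g, \det g = 1 & ~ is_scalar g].

Definition Cblk (g : mat) : 'M[C]_n.+1 := dlsubmx g.
Definition Dblk (g : mat) : 'M[C]_n.+1 := drsubmx g.

Definition Delta_g (g : mat) : set vec :=
  [set z | z != 0 /\
     vnorm (zpp z) <= vnorm (Cblk g *m zp z + Dblk g *m zpp z)].

Definition Delta (G : set mat) : set vec :=
  [set z | z != 0 /\ forall g, nontriv_SL G g -> Delta_g g z].

Definition Freg (G : set mat) : set vec := pt_interior (Delta G).
Definition Fbar (G : set mat) : set vec := pt_closure (Freg G).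
Definition bdFbar (G : set mat) : set vec := Fbar G `\` Freg G.

Definition Rset (G : set mat) : set R :=
  [set opnorm (invmx (Cblk g)) | g in nontriv_SL G].

Definition club (G : set mat) : Prop :=
  exists M : R, forall r, Rset G r -> r <= M.

Definition spade (G : set mat) : Prop :=
  forall x : R, x != 0 ->
    ~ (forall e : R, 0 < e -> exists r, [/\ Rset G r, r != x & `|r - x| < e]).

End Defs.

(* Main.v *)
(* Let f(z) = |z''|.  For g of determinant 1, f(gz) is well defined and the closed
   F-region is the set of points where f is minimal on the orbit.  Write
   a_g = A C^-1 and b_g = C^-1 D; since g(V_R) misses V_R, C is invertible and
   |a_g|, |b_g| <= R, and f(gz) = |C_g (z' + b_g z'')|.

   At an interior point z of {f <= f o g} one has f(z) < f(gz): otherwise the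
   quadratic form f(gy)^2 - f(y)^2 would have an interior minimum 0 in spite of a
   negative direction (z' + b_g z'' = 0).  This gives (1), (2) and (4); F is not
   empty because (club) puts a neighbourhood of {z'' = 0} in F.

   For (3), f(g_k z_k) is unbounded when z_k -> z in Omega and the g_k are distinct.
   Indeed the graphs of limits of the a_{g_k^-1} = - b_{g_k} are limit n-planes, so
   that z' + b_{g_k} z'' stays away from 0, while |C_{g_k}^-1| -> 0 by (club),
   (spade) and a finiteness argument on polynomial conditions.  So near z the minimum
   of f over the orbit is attained on a finite subset of Gamma, and in any ball one
   of the finitely many sets where a given element is minimal has interior
   points; such points are mapped into F. *)
Require Import Defs.
From HB Require Import structures.
From mathcomp Require Import all_boot all_order all_algebra.
From mathcomp Require Import complex.
From mathcomp Require Import classical_sets reals.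
From mathcomp Require Import perm boolp ring lra.
Import Order.TTheory GRing.Theory Num.Theory.
Local Open Scope ring_scope.
Local Open Scope classical_set_scope.

Set Implicit Arguments.
Unset Strict Implicit.
Unset Printing Implicit Defensive.

(** Two obstacles shape the argument. A limit n-plane is defined through the limit of the whole
    normalized compound matrix, so convergence of the graphs of [a_mx] is not enough: the column
    that carries them might be negligible against the other entries and vanish in the limit. This is
    excluded by bounding every entry of [compound g] by a constant times [\det (Cblk g)]. The other
    obstacle is that (spade) restricts which values the norm of [invmx (Cblk g)] takes, not how
    often it takes them. Equality of two such norms is not an algebraic condition; it is weakened to
    the statement that two Gram matrices share an eigenvalue, that is, that the determinant of a
    Sylvester operator vanishes. As a function of a group element and of the pair compared, this
    determinant is a finite sum of products, and so finitely many group elements decide it for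
    all. *)

Section ComplexModulus.
Variable R : realType.
Implicit Types z w : R[i].

Lemma cabsE z : cabs z = ComplexField.Normc.normc z.
Proof. by case: z. Qed.

Lemma cabs_ge0 z : 0 <= cabs z.
Proof. exact: sqrtr_ge0. Qed.

Lemma cabs0 : cabs (0 : R[i]) = 0.
Proof. by rewrite cabsE ComplexField.Normc.normc0. Qed.

Lemma cabs1 : cabs (1 : R[i]) = 1.
Proof. by rewrite cabsE ComplexField.Normc.normc1. Qed.

Lemma cabs_eq0 z : (cabs z == 0) = (z == 0).
Proof.
apply/eqP/eqP => [|->]; last exact: cabs0.
by rewrite cabsE => /ComplexField.Normc.eq0_normc.
Qed.

Lemma cabs_gt0 z : (0 < cabs z) = (z != 0).
Proof. by rewrite lt_def cabs_eq0 cabs_ge0 andbT. Qed.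

Lemma cabsM z w : cabs (z * w) = cabs z * cabs w.
Proof. by rewrite !cabsE ComplexField.Normc.normcM. Qed.

Lemma cabsV z : cabs z^-1 = (cabs z)^-1.
Proof. by rewrite !cabsE ComplexField.Normc.normcV. Qed.

Lemma cabsD z w : cabs (z + w) <= cabs z + cabs w.
Proof. by rewrite !cabsE le_normcD. Qed.

Lemma cabsN z : cabs (- z) = cabs z.
Proof. by rewrite !cabsE normcN. Qed.

Lemma cabsB z w : cabs (z - w) = cabs (w - z).
Proof. by rewrite -cabsN opprB. Qed.

Lemma cabs_ge_half z w : cabs (z - w) < cabs w / 2 -> cabs w / 2 <= cabs z.
Proof.
have := cabsD (w - z) z; rewrite subrK (cabsB w).
move: (cabs (z - w)) (cabs z) (cabs w) => p q t; lra.
Qed.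

Lemma cabs_sqr z : cabs z ^+ 2 = complex.Re z ^+ 2 + complex.Im z ^+ 2.
Proof. by rewrite sqr_sqrtr // addr_ge0 // sqr_ge0. Qed.

Lemma cabs_ler z : `|complex.Re z| <= cabs z.
Proof.
rewrite -(@ler_pXn2r _ 2%N) ?nnegrE ?cabs_ge0 //.
by rewrite cabs_sqr real_normK ?num_real // lerDl sqr_ge0.
Qed.

Lemma cabs_lei z : `|complex.Im z| <= cabs z.
Proof.
rewrite -(@ler_pXn2r _ 2%N) ?nnegrE ?cabs_ge0 //.
by rewrite cabs_sqr real_normK ?num_real // lerDr sqr_ge0.
Qed.

Lemma cabs_le_ReIm z : cabs z <= `|complex.Re z| + `|complex.Im z|.
Proof.
rewrite -(@ler_pXn2r _ 2%N) ?nnegrE ?cabs_ge0 ?addr_ge0 //.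
rewrite cabs_sqr sqrrD !real_normK ?num_real // lerD2r lerDl.
by rewrite mulrn_wge0 // mulr_ge0.
Qed.

Lemma cabsR (x : R) : cabs (x%:C)%C = `|x|.
Proof. by rewrite /cabs /= expr0n /= addr0 sqrtr_sqr. Qed.

Lemma cabsX z k : cabs (z ^+ k) = cabs z ^+ k.
Proof. by elim: k => [|k IH]; rewrite ?expr0 ?cabs1 // !exprS cabsM IH. Qed.

Lemma cabs_sum (I : Type) (s : seq I) (P : pred I) (F : I -> R[i]) :
  cabs (\sum_(i <- s | P i) F i) <= \sum_(i <- s | P i) cabs (F i).
Proof.
elim/big_rec2: _ => [|i y x _ le_xy]; first by rewrite cabs0.
by apply: le_trans (cabsD _ _) _; rewrite lerD2l.
Qed.

Lemma cabs_prod (I : Type) (s : seq I) (P : pred I) (F : I -> R[i]) :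
  cabs (\prod_(i <- s | P i) F i) = \prod_(i <- s | P i) cabs (F i).
Proof.
elim/big_rec2: _ => [|i y x _ <-]; first by rewrite cabs1.
by rewrite cabsM.
Qed.

Lemma cabs_sign (b : bool) : cabs ((-1) ^+ b : R[i]) = 1.
Proof. by case: b; rewrite ?expr1 ?cabsN ?expr0 cabs1. Qed.

Lemma cabs_det_le (m : nat) (A : 'M[R[i]]_m) (k : R) : 0 <= k ->
  (forall i j, cabs (A i j) <= k) -> cabs (\det A) <= (factorial m)%:R * k ^+ m.
Proof.
move=> k_ge0 Ak; apply: le_trans (cabs_sum _ _ _) _.
apply: (@le_trans _ _ (\sum_(s : 'S_m) k ^+ m)); last first.
  by rewrite sumr_const card_Sn mulr_natl.
apply: ler_sum => s _; rewrite cabsM cabs_sign mul1r cabs_prod.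
apply: (@le_trans _ _ (\prod_(i < m) k)); last by rewrite prodr_const card_ord.
by apply: ler_prod => i _; rewrite cabs_ge0 Ak.
Qed.

End ComplexModulus.

(** * The Euclidean norm of column vectors *)

Section EuclideanNorm.
Variable R : realType.
Local Notation C := R[i].

Lemma vnorm_sqr m (v : 'cV[C]_m) : vnorm v ^+ 2 = \sum_i cabs (v i 0) ^+ 2.
Proof. by rewrite sqr_sqrtr // sumr_ge0 // => i _; rewrite sqr_ge0. Qed.

Lemma vnorm_ge0 m (v : 'cV[C]_m) : 0 <= vnorm v.
Proof. exact: sqrtr_ge0. Qed.

Lemma vnorm0 m : vnorm (0 : 'cV[C]_m) = 0.
Proof.
apply/eqP; rewrite -[_ == _](@expf_eq0 _ _ 2%N) vnorm_sqr big1 // => i _.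
by rewrite mxE cabs0 expr0n.
Qed.

Lemma coord_le_vnorm m (v : 'cV[C]_m) i : cabs (v i 0) <= vnorm v.
Proof.
rewrite -(@ler_pXn2r _ 2%N) ?nnegrE ?cabs_ge0 ?vnorm_ge0 //.
rewrite vnorm_sqr (bigD1 i) //= lerDl sumr_ge0 // => j _; exact: sqr_ge0.
Qed.

Lemma vnorm_eq0 m (v : 'cV[C]_m) : (vnorm v == 0) = (v == 0).
Proof.
apply/eqP/eqP => [v0|->]; last exact: vnorm0.
apply/colP => i; rewrite mxE; apply/eqP; rewrite -cabs_eq0 eq_le cabs_ge0.
by rewrite -v0 coord_le_vnorm.
Qed.

Lemma vnorm_gt0 m (v : 'cV[C]_m) : (0 < vnorm v) = (v != 0).
Proof. by rewrite lt_def vnorm_eq0 vnorm_ge0 andbT. Qed.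

Lemma vnormZ m (a : C) (v : 'cV[C]_m) : vnorm (a *: v) = cabs a * vnorm v.
Proof.
apply/eqP; rewrite -(@eqrXn2 _ 2%N) ?mulr_ge0 ?vnorm_ge0 ?cabs_ge0 //.
rewrite exprMn !vnorm_sqr mulr_sumr; apply/eqP/eq_bigr => i _.
by rewrite mxE cabsM exprMn.
Qed.

Lemma vnormN m (v : 'cV[C]_m) : vnorm (- v) = vnorm v.
Proof. by rewrite -scaleN1r vnormZ cabsN cabs1 mul1r. Qed.

(* |a + b|^2 <= (1 + t)|a|^2 + (1 + 1/t)|b|^2 with t = |v| / |u| sums to the
   square of the triangle inequality. *)
Lemma vnormD m (u v : 'cV[C]_m) : vnorm (u + v) <= vnorm u + vnorm v.
Proof.
have [/eqP|u0] := boolP (vnorm u == 0).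
  by move/eqP; rewrite vnorm_eq0 => /eqP ->; rewrite add0r vnorm0 add0r.
have [/eqP|v0] := boolP (vnorm v == 0).
  by move/eqP; rewrite vnorm_eq0 => /eqP ->; rewrite addr0 vnorm0 addr0.
have {u0}up : 0 < vnorm u by rewrite lt_def u0 vnorm_ge0.
have {v0}vp : 0 < vnorm v by rewrite lt_def v0 vnorm_ge0.
set a := vnorm u in up *; set b := vnorm v in vp *.
rewrite -(@ler_pXn2r _ 2%N) ?nnegrE ?addr_ge0 ?vnorm_ge0 //.
have -> : (a + b) ^+ 2 = (1 + b / a) * a ^+ 2 + (1 + a / b) * b ^+ 2.
  by field; rewrite !gt_eqF.
rewrite vnorm_sqr {2}/a {3}/b !vnorm_sqr !mulr_sumr -big_split /=.
apply: ler_sum => i _.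
rewrite mxE; set x := u i 0; set y := v i 0.
have h : cabs (x + y) ^+ 2 <= (cabs x + cabs y) ^+ 2.
  by rewrite ler_pXn2r ?nnegrE ?addr_ge0 ?cabs_ge0 // cabsD.
apply: le_trans h _; set p := cabs x; set q := cabs y.
rewrite -subr_ge0.
have -> : (1 + b / a) * p ^+ 2 + (1 + a / b) * q ^+ 2 - (p + q) ^+ 2
   = (b * p - a * q) ^+ 2 / (a * b) by field; rewrite !gt_eqF.
by rewrite mulr_ge0 ?sqr_ge0 // invr_ge0 mulr_ge0 // ltW.
Qed.

Lemma vnormB m (u v : 'cV[C]_m) : vnorm (u - v) = vnorm (v - u).
Proof. by rewrite -vnormN opprB. Qed.

Lemma vnorm_subr_le m (u v : 'cV[C]_m) : vnorm u - vnorm v <= vnorm (u - v).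
Proof. by rewrite lerBlDr -{1}(subrK v u) vnormD. Qed.

Lemma vnorm_parallelogram m (u v : 'cV[C]_m) :
  vnorm (u + v) ^+ 2 + vnorm (u - v) ^+ 2 = 2 * (vnorm u ^+ 2 + vnorm v ^+ 2).
Proof.
rewrite !vnorm_sqr -!big_split /= mulr_sumr; apply: eq_bigr => i _.
rewrite !mxE !cabs_sqr; case: (u i 0) => a b; case: (v i 0) => c d /=.
ring.
Qed.

Lemma vnorm_le_sum m (v : 'cV[C]_m) : vnorm v <= \sum_i cabs (v i 0).
Proof.
rewrite -(@ler_pXn2r _ 2%N) ?nnegrE ?vnorm_ge0 ?sumr_ge0 //; last first.
  by move=> i _; exact: cabs_ge0.
rewrite vnorm_sqr expr2 mulr_suml; apply: ler_sum => i _.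
rewrite expr2 ler_wpM2l ?cabs_ge0 // (bigD1 i) //= lerDl sumr_ge0 // => j _.
exact: cabs_ge0.
Qed.

(** A crude Lipschitz constant. It shows that the set under the supremum in [opnorm] is bounded,
    which must be known before that supremum can be used. *)
Definition entry_sum m p (A : 'M[C]_(m, p)) : R := \sum_i \sum_j cabs (A i j).

Lemma entry_sum_ge0 m p (A : 'M[C]_(m, p)) : 0 <= entry_sum A.
Proof. by apply: sumr_ge0 => i _; apply: sumr_ge0 => j _; exact: cabs_ge0. Qed.

Lemma vnorm_mulmx_le m p (A : 'M[C]_(m, p)) (v : 'cV[C]_p) :
  vnorm (A *m v) <= entry_sum A * vnorm v.
Proof.
apply: le_trans (vnorm_le_sum _) _; rewrite mulr_suml; apply: ler_sum => i _.
rewrite mxE mulr_suml; apply: le_trans (cabs_sum _ _ _) _.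
by apply: ler_sum => j _; rewrite cabsM ler_wpM2l ?cabs_ge0 ?coord_le_vnorm.
Qed.

Lemma vnorm_delta m (i : 'I_m) : vnorm (delta_mx i 0 : 'cV[C]_m) = 1.
Proof.
apply/eqP; rewrite -(@eqrXn2 _ 2%N) ?vnorm_ge0 // vnorm_sqr (bigD1 i) //=.
rewrite mxE !eqxx cabs1 !expr1n big1 ?addr0 // => j ne_ji.
by rewrite mxE (negbTE ne_ji) cabs0 expr0n.
Qed.

Lemma entry_le_of_vnorm m p (A : 'M[C]_(m, p)) (k : R) :
  (forall v, vnorm (A *m v) <= k * vnorm v) -> forall i j, cabs (A i j) <= k.
Proof.
move=> Ak i j; have := Ak (delta_mx j 0); rewrite vnorm_delta mulr1.
apply: le_trans; have := coord_le_vnorm (A *m delta_mx j 0) i.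
by rewrite -colE mxE.
Qed.

Lemma usubmx_le_vnorm m p (v : 'cV[C]_(m + p)) : vnorm (usubmx v) <= vnorm v.
Proof.
rewrite -(@ler_pXn2r _ 2%N) ?nnegrE ?vnorm_ge0 // !vnorm_sqr big_split_ord /=.
under eq_bigr do rewrite mxE.
by rewrite lerDl sumr_ge0 // => i _; exact: sqr_ge0.
Qed.

Lemma dsubmx_le_vnorm m p (v : 'cV[C]_(m + p)) : vnorm (dsubmx v) <= vnorm v.
Proof.
rewrite -(@ler_pXn2r _ 2%N) ?nnegrE ?vnorm_ge0 // !vnorm_sqr big_split_ord /=.
under eq_bigr do rewrite mxE.
by rewrite lerDr sumr_ge0 // => i _; exact: sqr_ge0.
Qed.

End EuclideanNorm.

(** * The operator norm as a supremum over the unit sphere *)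

Section OperatorNorm.
Variables (R : realType) (m : nat).
Implicit Type A : 'M[R[i]]_m.+1.

(** The size is [m.+1] because the unit sphere is empty in dimension 0. *)
Lemma has_sup_opnorm A :
  has_sup [set vnorm (A *m v) | v in [set v : 'cV_m.+1 | vnorm v = 1]].
Proof.
split; first by exists (vnorm (A *m delta_mx ord0 0)); exists (delta_mx ord0 0) => //; exact: vnorm_delta.
exists (entry_sum A) => _ [v v1 <-].
by have := vnorm_mulmx_le A v; rewrite v1 mulr1.
Qed.

Lemma opnorm_ge0 A : 0 <= opnorm A.
Proof.
apply: (@le_trans _ _ (vnorm (A *m delta_mx ord0 0))); first exact: vnorm_ge0.
apply: sup_upper_bound; first exact: has_sup_opnorm.
by exists (delta_mx ord0 0) => //; exact: vnorm_delta.
Qed.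

Lemma opnorm_mulmx A v : vnorm (A *m v) <= opnorm A * vnorm v.
Proof.
have [->|v0] := eqVneq v 0; first by rewrite mulmx0 !vnorm0 mulr0.
have vp : 0 < vnorm v by rewrite vnorm_gt0.
pose c : R[i] := ((vnorm v)^-1)%:C%C.
have cabsc : cabs c = (vnorm v)^-1 by rewrite cabsR ger0_norm // invr_ge0 ltW.
have : vnorm (A *m (c *: v)) <= opnorm A.
  apply: sup_upper_bound; first exact: has_sup_opnorm.
  by exists (c *: v) => //=; rewrite vnormZ cabsc mulVf ?gt_eqF.
by rewrite -scalemxAr vnormZ cabsc mulrC ler_pdivrMr.
Qed.

Lemma opnorm_leP A k : (forall v, vnorm (A *m v) <= k * vnorm v) -> opnorm A <= k.
Proof.
move=> Ak; apply: ge_sup; first by have [] := has_sup_opnorm A.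
by move=> _ [v v1 <-]; rewrite -[k]mulr1 -[X in _ * X]v1.
Qed.

Lemma opnormM_le A B : opnorm (A *m B) <= opnorm A * opnorm B.
Proof.
apply: opnorm_leP => v; rewrite -mulmxA.
apply: le_trans (opnorm_mulmx _ _) _; rewrite -mulrA.
by rewrite ler_wpM2l ?opnorm_ge0 ?opnorm_mulmx.
Qed.

Lemma opnorm_gt0 A : A \in unitmx -> 0 < opnorm A.
Proof.
move=> uA; rewrite lt_def opnorm_ge0 andbT; apply/negP => /eqP A0.
have := opnorm_mulmx A (delta_mx ord0 0); rewrite A0 mul0r => h.
have : A *m (delta_mx ord0 0 : 'cV_m.+1) == 0 by rewrite -vnorm_eq0 eq_le h vnorm_ge0.
move/eqP/(congr1 (mulmx (invmx A))); rewrite mulKmx // mulmx0 => e.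
by have := vnorm_delta R (@ord0 m); rewrite e vnorm0 => /eqP; rewrite eq_sym oner_eq0.
Qed.

Lemma opnorm_invmx_lower A v : A \in unitmx -> vnorm v <= opnorm (invmx A) * vnorm (A *m v).
Proof. by move=> uA; rewrite -{1}(mulKmx uA v) opnorm_mulmx. Qed.

End OperatorNorm.

(** * Convergence of complex sequences and extraction of subsequences *)

Section Sequences.
Variable R : realType.
Local Notation C := R[i].

(** The epsilon form matches [nconv], so that limits pass between the two entry by entry. *)
Definition cvc (u : nat -> C) (l : C) : Prop :=
  forall e : R, 0 < e -> exists k0, forall k, (k0 <= k)%N -> cabs (u k - l) < e.

Lemma cvc_eq (u v : nat -> C) l : u =1 v -> cvc u l -> cvc v l.
Proof.
by move=> uv ul e e0; have [k0 h] := ul e e0; exists k0 => k /h; rewrite uv.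
Qed.

Lemma cvc_cst c : cvc (fun=> c) c.
Proof. by move=> e e0; exists 0%N => k _; rewrite subrr cabs0. Qed.

Lemma cvcD u v l l' : cvc u l -> cvc v l' -> cvc (fun k => u k + v k) (l + l').
Proof.
move=> ul vl e e0; have e2 : 0 < e / 2 by rewrite divr_gt0.
have [k0 h0] := ul _ e2; have [k1 h1] := vl _ e2.
exists (maxn k0 k1) => k; rewrite geq_max => /andP[/h0 a /h1 b].
rewrite [e]splitr opprD addrACA; apply: le_lt_trans (cabsD _ _) _.
exact: ltrD.
Qed.

Lemma cvc_bounded u l : cvc u l ->
  exists2 M : R, 0 < M & exists k0, forall k, (k0 <= k)%N -> cabs (u k) <= M.
Proof.
move=> ul; exists (cabs l + 1); first by rewrite ltr_wpDl ?cabs_ge0.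
have [k0 h] := ul 1 ltr01; exists k0 => k /h a.
rewrite -(subrK l (u k)) addrC; apply: le_trans (cabsD _ _) _.
by rewrite lerD2l ltW.
Qed.

Lemma cvcM u v l l' : cvc u l -> cvc v l' -> cvc (fun k => u k * v k) (l * l').
Proof.
move=> ul vl e e0; have [M M0 [k2 h2]] := cvc_bounded vl.
have e1 : 0 < e / 2 / M by rewrite !divr_gt0.
have L0 : 0 < cabs l + 1 by rewrite ltr_wpDl ?cabs_ge0.
have e2 : 0 < e / 2 / (cabs l + 1) by rewrite !divr_gt0.
have [k0 h0] := ul _ e1; have [k1 h1] := vl _ e2.
exists (maxn k2 (maxn k0 k1)) => k; rewrite !geq_max => /and3P[/h2 c /h0 a /h1 b].
have -> : u k * v k - l * l' = (u k - l) * v k + l * (v k - l') by ring.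
apply: le_lt_trans (cabsD _ _) _; rewrite !cabsM [e]splitr.
have ab : cabs (u k - l) * cabs (v k) <= cabs (u k - l) * M.
  by rewrite ler_wpM2l ?cabs_ge0.
have a' : cabs (u k - l) * M < e / 2 by rewrite -ltr_pdivlMr.
apply: ltr_leD; first exact: le_lt_trans ab a'.
move: b; rewrite ltr_pdivlMr // mulrC => /ltW; apply: le_trans.
by rewrite ler_wpM2r ?cabs_ge0 // lerDl.
Qed.

Lemma cvc_sum (I : Type) (s : seq I) (P : pred I) (u : nat -> I -> C) (l : I -> C) :
  (forall i, cvc (u^~ i) (l i)) ->
  cvc (fun k => \sum_(i <- s | P i) u k i) (\sum_(i <- s | P i) l i).
Proof.
move=> ul; elim: s => [|i s IH].
  by rewrite big_nil; apply: cvc_eq (cvc_cst 0) => k; rewrite big_nil.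
rewrite big_cons; case: ifP => Pi; last first.
  by apply: cvc_eq IH => k; rewrite big_cons Pi.
by apply: cvc_eq (cvcD (ul i) IH) => k; rewrite big_cons Pi.
Qed.

Lemma cvc_prod (I : Type) (s : seq I) (P : pred I) (u : nat -> I -> C) (l : I -> C) :
  (forall i, cvc (u^~ i) (l i)) ->
  cvc (fun k => \prod_(i <- s | P i) u k i) (\prod_(i <- s | P i) l i).
Proof.
move=> ul; elim: s => [|i s IH].
  by rewrite big_nil; apply: cvc_eq (cvc_cst 1) => k; rewrite big_nil.
rewrite big_cons; case: ifP => Pi; last first.
  by apply: cvc_eq IH => k; rewrite big_cons Pi.
by apply: cvc_eq (cvcM (ul i) IH) => k; rewrite big_cons Pi.
Qed.

Lemma cvc_det m (A : nat -> 'M[C]_m) (L : 'M[C]_m) :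
  (forall i j, cvc (fun k => A k i j) (L i j)) -> cvc (fun k => \det (A k)) (\det L).
Proof.
move=> AL; rewrite /determinant; apply: cvc_sum => s; apply: cvcM.
  exact: cvc_cst.
exact: (@cvc_prod _ _ xpredT (fun k i => A k i (s i)) (fun i => L i (s i))).
Qed.

Lemma cvc_unique u l l' : cvc u l -> cvc u l' -> l = l'.
Proof.
move=> ul ul'; apply/eqP; rewrite -subr_eq0 -cabs_eq0; apply/negPn/negP => d0.
have {}d0 : 0 < cabs (l - l') by rewrite lt_def d0 cabs_ge0.
have e0 : 0 < cabs (l - l') / 2 by rewrite divr_gt0.
have [k0 h0] := ul _ e0; have [k1 h1] := ul' _ e0.
have a := h0 (maxn k0 k1) (leq_maxl _ _); have b := h1 (maxn k0 k1) (leq_maxr _ _).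
set w := u _ in a b; have := cabsD (l - w) (w - l').
by rewrite addrA subrK (cabsB l) leNgt [cabs (l - l')]splitr ltrD.
Qed.

Definition increasing (phi : nat -> nat) := forall k l, (k < l)%N -> (phi k < phi l)%N.

Lemma increasing_ge phi : increasing phi -> forall k, (k <= phi k)%N.
Proof.
by move=> inc; elim=> // k IH; apply: leq_ltn_trans IH _; apply: inc.
Qed.

Lemma increasing_inj phi : increasing phi -> injective phi.
Proof.
move=> inc k l e; case: (ltngtP k l) => // /inc; rewrite e ltnn //.
Qed.

Lemma increasing_comp phi psi :
  increasing phi -> increasing psi -> increasing (phi \o psi).
Proof. by move=> a b k l /b /a. Qed.

Lemma cvc_subseq u l phi : increasing phi -> cvc u l -> cvc (u \o phi) l.
Proof.
move=> inc ul e e0; have [k0 h] := ul e e0; exists k0 => k lek /=; apply: h.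
exact: leq_trans lek (increasing_ge inc k).
Qed.

Lemma increasing_subseq (P : nat -> nat -> Prop) :
  (forall k K, exists2 l, (K <= l)%N & P k l) ->
  exists2 phi, increasing phi & forall k, P k (phi k).
Proof.
move=> ex; have [N N_P] : {N : nat -> nat -> nat |
    forall k K, (K <= N k K)%N /\ P k (N k K)}.
  apply: cid; have /choice[f fP] : forall kK : nat * nat,
      exists l, (kK.2 <= l)%N /\ P kK.1 l.
    by move=> kK; have [l a b] := ex kK.1 kK.2; exists l.
  by exists (fun k K => f (k, K)) => k K; exact: (fP (k, K)).
pose phi := fix phi k := if k is k'.+1 then N k (phi k').+1 else N 0%N 0%N.
exists phi; last by case=> [|k]; apply: (N_P _ _).2.
move=> k l; apply: (@homo_ltn _ phi (fun a b => a < b)%N).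
  by move=> y x z; exact: ltn_trans.
by move=> i; exact: (N_P _ _).1.
Qed.

(* The cluster point is the limsup of the sequence. *)
Lemma real_cluster (u : nat -> R) (lo hi : R) :
  (forall k, lo <= u k <= hi) ->
  exists2 x, lo <= x & forall e, 0 < e -> forall K,
    exists2 k, (K <= k)%N & `|u k - x| < e.
Proof.
move=> ub; pose S := [set t : R | forall K, exists2 k, (K <= k)%N & t <= u k].
have Slo : S lo by move=> K; exists K => //; case/andP: (ub K).
have supS : has_sup S.
  split; first by exists lo.
  by exists hi => t /(_ 0%N)[k _ /le_trans]; apply; case/andP: (ub k).
exists (sup S); first exact: sup_upper_bound.
move=> e e0 K; have [t St lt_t] := sup_adherent e0 supS.
have [K0 K0P] : exists K0, forall k, (K0 <= k)%N -> u k < sup S + e / 2.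
  apply: contrapT => h; have : S (sup S + e / 2).
    move=> K1; apply: contrapT => h1; apply: h; exists K1 => k lek.
    by rewrite ltNge; apply/negP => le_u; apply: h1; exists k.
  move=> /(sup_upper_bound supS); rewrite leNgt ltrDl divr_gt0 //.
have [k lek le_u] := St (maxn K K0); move: lek; rewrite geq_max => /andP[leK leK0].
exists k => //; have := K0P k leK0; move: le_u lt_t e0.
rewrite ltr_norml; lra.
Qed.

Lemma real_subseq (u : nat -> R) (M : R) : (forall k, `|u k| <= M) ->
  exists2 phi, increasing phi & exists x, forall e, 0 < e -> exists k0,
    forall k, (k0 <= k)%N -> `|u (phi k) - x| < e.
Proof.
move=> uM; have ub k : - M <= u k <= M by rewrite -ler_norml.
have [x _ xP] := real_cluster ub.
have [k K|phi inc phiP] := @increasing_subseq (fun k l => `|u l - x| < k.+1%:R^-1).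
  by apply: xP; rewrite invr_gt0.
exists phi => //; exists x => e e0; exists (Num.truncn e^-1) => k lek.
apply: lt_le_trans (phiP k) _; rewrite -[e]invrK lef_pV2 ?posrE ?invr_gt0 //.
apply/ltW; apply: lt_le_trans (truncnS_gt _) _.
by rewrite ler_nat ltnS.
Qed.

Lemma cvc_extract (u : nat -> C) (M : R) : (forall k, cabs (u k) <= M) ->
  exists2 phi, increasing phi & exists l, cvc (u \o phi) l.
Proof.
move=> uM.
have [|phi incphi [x xP]] := @real_subseq (fun k => complex.Re (u k)) M.
  by move=> k; exact: le_trans (cabs_ler _) (uM k).
have [|psi incpsi [y yP]] := @real_subseq (fun k => complex.Im (u (phi k))) M.
  by move=> k; exact: le_trans (cabs_lei _) (uM _).
exists (phi \o psi); first exact: increasing_comp.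
exists (Complex x y) => e e0; have e2 : 0 < e / 2 by rewrite divr_gt0.
have [k0 h0] := xP _ e2; have [k1 h1] := yP _ e2.
exists (maxn k0 k1) => k; rewrite geq_max => /andP[lek0 /h1 b].
have a := h0 (psi k) (leq_trans lek0 (increasing_ge incpsi k)).
apply: le_lt_trans (cabs_le_ReIm _) _; rewrite [e]splitr /=.
by move: a b; case: (u _) => p q /= a b; apply: ltrD.
Qed.

Lemma cvc_extract_fin (I : finType) (u : nat -> I -> C) (M : R) :
  (forall k i, cabs (u k i) <= M) ->
  exists2 phi, increasing phi & exists l : I -> C, forall i,
    cvc (fun k => u (phi k) i) (l i).
Proof.
move=> uM; suff [phi inc [l lP]] : exists2 phi, increasing phi &
    exists l : I -> C, forall i, i \in enum I -> cvc (fun k => u (phi k) i) (l i).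
  by exists phi => //; exists l => i; apply: lP; rewrite mem_enum.
elim: (enum I) => [|i s [phi inc [l lP]]]; first by exists id => //; exists (fun=> 0).
have [|psi inc' [x xP]] := @cvc_extract (fun k => u (phi k) i) M; first by [].
exists (phi \o psi); first exact: increasing_comp.
exists (fun j => if j == i then x else l j) => j; rewrite in_cons.
have [-> _|_ /= js] := eqVneq j i; first exact: xP.
exact: (cvc_subseq inc' (lP j js)).
Qed.

Lemma cvc_unif (I : finType) (u : nat -> I -> C) (l : I -> C) :
  (forall i, cvc (u^~ i) (l i)) -> forall e, 0 < e ->
  exists k0, forall k, (k0 <= k)%N -> forall i, cabs (u k i - l i) < e.
Proof.
move=> ul e e0; have /choice[K KP] := fun i => ul i e e0.
exists (\max_i K i)%N => k lek i; apply: KP; apply: leq_trans lek.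
exact: (@leq_bigmax _ K i).
Qed.

Lemma normalize (I J : finType) (M : I -> J -> C) :
  (exists i j, M i j != 0) ->
  exists2 a : C, a != 0 & normalized (fun i j => a * M i j).
Proof.
case=> i0 [j0 M0].
have [[i1 j1] _ max] := @arg_maxP _ _ _ (i0, j0) predT
  (fun p : I * J => cabs (M p.1 p.2)) isT.
have M1 : M i1 j1 != 0.
  by rewrite -cabs_gt0 (lt_le_trans _ (max (i0, j0) isT)) // cabs_gt0.
exists (M i1 j1)^-1; first by rewrite invr_eq0.
split; last by exists i1, j1; rewrite mulVf // cabs1.
move=> i j; rewrite cabsM cabsV ler_pdivrMl ?cabs_gt0 // mulr1.
exact: (max (i, j) isT).
Qed.

Lemma nconv_cvc (I J : finType) (s : nat -> I -> J -> C) T :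
  nconv s T -> exists lam : nat -> C,
    (forall k, lam k != 0 /\ normalized (fun i j => lam k * s k i j)) /\
    forall i j, cvc (fun k => lam k * s k i j) (T i j).
Proof.
case=> lam [lamP cv]; exists lam; split=> // i j e /cv[k0 h].
by exists k0 => k /h.
Qed.

(** The entry of modulus 1 may move with k, but a single k at which all entries are within 1 of the
    limit suffices. *)
Lemma nconv_neq0 (I J : finType) (s : nat -> I -> J -> C) T :
  nconv s T -> exists i j, T i j != 0.
Proof.
case=> lam [lamP cv]; have [k0 /(_ k0 (leqnn _)) h] := cv 1 ltr01.
have [_ [_ [i [j eq1]]]] := lamP k0; exists i, j; apply/negP => /eqP T0.
by have := h i j; rewrite T0 subr0 eq1 ltxx.
Qed.

End Sequences.

(** The lower bound [e] keeps the cluster point away from 0; there the set is isolated, so closeness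
    to the cluster point becomes equality with it. *)
Lemma repeated_value (R : realType) (D : set R) (u : nat -> R) (e M : R) :
  (forall x : R, x != 0 ->
     ~ (forall e, 0 < e -> exists t, [/\ D t, t != x & `|t - x| < e])) ->
  0 < e -> (forall k, D (u k)) -> (forall k, e <= u k <= M) ->
  exists x, forall K, exists2 k, (K <= k)%N & u k = x.
Proof.
move=> isol e0 uD uM; have [x ex xP] := real_cluster uM.
have /isol nacc : x != 0 by rewrite gt_eqF // (lt_le_trans e0).
have [d d0 dP] : exists2 d, 0 < d & forall t, D t -> `|t - x| < d -> t = x.
  apply: contrapT => h; apply: nacc => d d0; apply: contrapT => h1.
  apply: h; exists d => // t Dt td; apply: contrapT => tx; apply: h1.
  by exists t; split=> //; apply/eqP.
by exists x => K; have [k lek /dP ukx] := xP d d0 K; exists k => //; apply: ukx.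
Qed.

(** Applied with A and A' the adjoints of B and of its inverse: an eigenvector of the Gram matrix of
    the inverse is turned into one of the Gram matrix of B. *)
Lemma mulmx_eigen_transfer (K : fieldType) m (A A' B : 'M[K]_m) (w : 'cV_m) t :
  B \in unitmx -> A *m A' = 1%:M -> w = t *: (A' *m (invmx B *m w)) ->
  A *m B *m (invmx B *m w) = t *: (invmx B *m w).
Proof.
move=> uB AA' ew; rewrite -mulmxA mulKVmx // {1}ew -scalemxAr mulmxA AA'.
by rewrite mul1mx.
Qed.

(** * Adjoints, least singular values and the Sylvester operator *)

Section Adjoint.
Variable R : realType.
Local Notation C := R[i].

Definition adj m p (A : 'M[C]_(m, p)) : 'M[C]_(p, m) := map_mx conjc A^T.

Lemma adjM m p q (A : 'M[C]_(m, p)) (B : 'M[C]_(p, q)) :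
  adj (A *m B) = adj B *m adj A.
Proof. by rewrite /adj trmx_mul map_mxM. Qed.

Lemma adjK m p (A : 'M[C]_(m, p)) : adj (adj A) = A.
Proof. by apply/matrixP => i j; rewrite !mxE conjcK. Qed.

Lemma adjZ m p (t : R) (A : 'M[C]_(m, p)) : adj (t%:C%C *: A) = t%:C%C *: adj A.
Proof. by apply/matrixP => i j; rewrite !mxE rmorphM /= oppr0. Qed.

Lemma adj1 m : adj (1%:M : 'M[C]_m) = 1%:M.
Proof. by rewrite /adj trmx1 map_mx1. Qed.

Lemma adj_unit m (A : 'M[C]_m) : (adj A \in unitmx) = (A \in unitmx).
Proof. by rewrite /adj map_unitmx unitmx_tr. Qed.

(** The real part of the Hermitian product, that is, the inner product of the underlying real space;
    the gradient step below has a real step size. *)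
Definition ip m (u v : 'cV[C]_m) : R := complex.Re ((adj u *m v) 0 0).

Lemma ipE m (u v : 'cV[C]_m) : ip u v =
  \sum_i (complex.Re (u i 0) * complex.Re (v i 0)
          + complex.Im (u i 0) * complex.Im (v i 0)).
Proof.
rewrite /ip mxE; elim/big_rec2: _ => [//|i x y _ eq_x].
rewrite !mxE; case: (u i 0) => a b; case: (v i 0) => c d.
by case: y eq_x => p q /= ->; ring.
Qed.

Lemma ip_adj m p (A : 'M[C]_(m, p)) u v : ip u (A *m v) = ip (adj A *m u) v.
Proof. by rewrite /ip adjM adjK mulmxA. Qed.

Lemma ipBl m (u u' v : 'cV[C]_m) : ip (u - u') v = ip u v - ip u' v.
Proof.
rewrite !ipE -sumrB; apply: eq_bigr => i _; rewrite !mxE.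
by case: (u i 0) => a b; case: (u' i 0) => c d /=; ring.
Qed.

Lemma ipZl m (t : R) (u v : 'cV[C]_m) : ip (t%:C%C *: u) v = t * ip u v.
Proof.
rewrite !ipE mulr_sumr; apply: eq_bigr => i _; rewrite !mxE.
by case: (u i 0) => a b /=; ring.
Qed.

Lemma vnorm_subZ_sqr m (u v : 'cV[C]_m) (s : R) :
  vnorm (u - s%:C%C *: v) ^+ 2 = vnorm u ^+ 2 - 2 * s * ip u v + s ^+ 2 * vnorm v ^+ 2.
Proof.
rewrite ipE !vnorm_sqr !mulr_sumr -sumrB -big_split /=; apply: eq_bigr => i _.
rewrite !cabs_sqr !mxE; case: (u i 0) => a b; case: (v i 0) => c d /=; ring.
Qed.

Lemma ipvv m (v : 'cV[C]_m) : ip v v = vnorm v ^+ 2.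
Proof. by rewrite ipE vnorm_sqr; apply: eq_bigr => i _; rewrite cabs_sqr. Qed.

(* If rho^2 - A^*A were invertible, a gradient step in the nonnegative form
   q(v) = rho^2 |v|^2 - |A v|^2 would bound q below by c |v|^2 with c > 0, and
   rho would not be the supremum. *)
Lemma opnorm_singular m (A : 'M[C]_m.+1) : 0 < opnorm A ->
  \det ((opnorm A ^+ 2)%:C%C%:M - adj A *m A) = 0.
Proof.
have := opnorm_mulmx A; have := @opnorm_leP _ _ A.
move: (opnorm A) => rho rho_min rhoP rho0; set H := _ - _.
apply/eqP/negPn/negP => dH.
have uH : H \in unitmx by rewrite unitmxE unitfE.
have [k k0 kP] : exists2 k, 0 < k & forall v, vnorm v <= k * vnorm (H *m v).
  exists (opnorm (invmx H)); first by apply: opnorm_gt0; rewrite unitmx_inv.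
  by move=> v; exact: opnorm_invmx_lower.
have qle v : vnorm (A *m v) ^+ 2 <= rho ^+ 2 * vnorm v ^+ 2.
  rewrite -exprMn ler_pXn2r ?nnegrE ?vnorm_ge0 //.
  by rewrite mulr_ge0 ?vnorm_ge0 // (ltW rho0).
(* With step [s = 1 / rho^2] one has [2 s - s^2 rho^2 = s], so q >= 0 at [v - s H v] yields q(v) >=
   s |H v|^2 >= (s / k^2) |v|^2, and c = s / k^2. *)
pose c := (rho ^+ 2 * k ^+ 2)^-1.
have c0 : 0 < c by rewrite invr_gt0 mulr_gt0 // exprn_gt0.
have key v : vnorm (A *m v) ^+ 2 <= (rho ^+ 2 - c) * vnorm v ^+ 2.
  set w := H *m v; pose s := (rho ^+ 2)^-1.
  have ipw : rho ^+ 2 * ip v w - ip (A *m v) (A *m w) = vnorm w ^+ 2.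
    by rewrite -ipvv {3}/w /H mulmxBl mul_scalar_mx ipBl ipZl ip_adj mulmxA.
  move: (kP v) ipw; rewrite -/w; move: w => w kPw ipw.
  have := qle (v - s%:C%C *: w).
  rewrite mulmxBr -(scalemxAr s%:C%C A w) 2!vnorm_subZ_sqr => h1.
  have h3 : vnorm v ^+ 2 <= k ^+ 2 * vnorm w ^+ 2.
    rewrite -exprMn ler_pXn2r ?nnegrE ?vnorm_ge0 //.
    by rewrite mulr_ge0 ?vnorm_ge0 // (ltW k0).
  have r2 : 0 < rho ^+ 2 by rewrite exprn_gt0.
  have h4 : c * vnorm v ^+ 2 <= s * vnorm w ^+ 2.
    have -> : c * vnorm v ^+ 2 = s * (vnorm v ^+ 2 / k ^+ 2).
      by rewrite /c /s; field; rewrite !gt_eqF.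
    rewrite ler_wpM2l ?invr_ge0 ?(ltW r2) // ler_pdivrMr ?exprn_gt0 //.
    by rewrite mulrC.
  have h5 : 0 <= s ^+ 2 * vnorm (A *m w) ^+ 2 by rewrite mulr_ge0 ?sqr_ge0.
  have es : s ^+ 2 * (rho ^+ 2 * vnorm w ^+ 2) = s * vnorm w ^+ 2.
    by rewrite /s; field; rewrite gt_eqF.
  move: h1.
  have -> : rho ^+ 2 * (vnorm v ^+ 2 - 2 * s * ip v w + s ^+ 2 * vnorm w ^+ 2)
    = rho ^+ 2 * vnorm v ^+ 2 - 2 * s * (vnorm w ^+ 2 + ip (A *m v) (A *m w))
      + s * vnorm w ^+ 2.
    by rewrite -es -ipw; ring.
  move: h4 h5; lra.
(* [Num.sqrt] is 0 on negative arguments, so the sign must be known before squaring; a unit vector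
   in [key] gives it. *)
have c_le : 0 <= rho ^+ 2 - c.
  have := key (delta_mx ord0 0); rewrite vnorm_delta expr1n mulr1.
  by apply: le_trans; rewrite sqr_ge0.
suff : rho <= Num.sqrt (rho ^+ 2 - c).
  rewrite -(@ler_pXn2r _ 2%N) ?nnegrE ?sqrtr_ge0 ?(ltW rho0) // sqr_sqrtr //.
  by rewrite leNgt gtrBl c0.
apply: rho_min => v; rewrite -(@ler_pXn2r _ 2%N) ?nnegrE ?vnorm_ge0 //; last first.
  by rewrite mulr_ge0 ?sqrtr_ge0 ?vnorm_ge0.
by rewrite exprMn (sqr_sqrtr c_le) key.
Qed.

(** The inverse of |B^-1| is the least singular value of B. Hence matrices with equal |B^-1| have
    Gram matrices with a common eigenvalue. *)
Lemma opnorm_invmx_eigen m (B : 'M[C]_m.+1) : B \in unitmx ->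
  exists2 u : 'cV[C]_m.+1, u != 0 &
    adj B *m B *m u = ((opnorm (invmx B)) ^- 2)%:C%C *: u.
Proof.
move=> uB; have rho0 := opnorm_gt0 (etrans (unitmx_inv B) uB).
have /eqP := opnorm_singular rho0.
move: (opnorm _) rho0 => rho rho0; rewrite -det_tr => /det0P[v v0 /(congr1 trmx)].
rewrite trmx_mul trmxK trmx0 mulmxBl mul_scalar_mx => /eqP.
rewrite subr_eq0; set w := v^T => /eqP eqw.
have w0 : w != 0 by rewrite -(inj_eq trmx_inj) trmxK trmx0.
exists (invmx B *m w).
  apply: contraNneq w0 => /(congr1 (mulmx B)).
  by rewrite mulKVmx // mulmx0 => ->.
have r2 : rho ^+ 2 != 0 by rewrite expf_neq0 // gt_eqF.
have ew : w = (rho ^- 2)%:C%C *: (adj (invmx B) *m (invmx B *m w)).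
  by rewrite (mulmxA (adj _)) -eqw scalerA -rmorphM /= mulVf // scale1r.
have aB : adj B *m adj (invmx B) = 1%:M by rewrite -adjM mulVmx // adj1.
exact: mulmx_eigen_transfer uB aB ew.
Qed.

(** The Sylvester operator X -> P X - X Q on flattened matrices. Its determinant is, up to sign, the
    resultant of the two characteristic polynomials. *)
Definition sylv m (P Q : 'M[C]_m) : 'M[C]_(m * m) := lin_mulmx P - lin_mulmxr Q.

Lemma mxvec_sylv m (P Q X : 'M[C]_m) :
  mxvec X *m sylv P Q = mxvec (P *m X - X *m Q).
Proof. by rewrite mulmxBr !mul_vec_lin linearB. Qed.

(** The rank one product of u with the adjoint of w lies in the kernel: as Q is Hermitian and t
    real, the adjoint of w is a left eigenvector of Q. *)
Lemma sylv_common m (P Q : 'M[C]_m) (t : R) (u w : 'cV[C]_m) :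
  adj Q = Q -> u != 0 -> w != 0 ->
  P *m u = t%:C%C *: u -> Q *m w = t%:C%C *: w -> \det (sylv P Q) = 0.
Proof.
move=> hQ u0 w0 Pu Qw; apply/eqP/det0P; exists (mxvec (u *m adj w)); last first.
  have Qw' : adj w *m Q = t%:C%C *: adj w by rewrite -{1}hQ -adjM Qw adjZ.
  rewrite mxvec_sylv (mulmxA P) Pu -(mulmxA u) Qw'.
  by rewrite -scalemxAl -scalemxAr subrr linear0.
apply: contraNneq w0 => /(congr1 vec_mx); rewrite mxvecK linear0 => uw0.
have /existsP[i ui0] : [exists i, u i 0 != 0].
  apply: contraNT u0; rewrite negb_exists => /forallP u0.
  by apply/eqP/colP => i; rewrite mxE; apply/eqP/negPn/u0.
apply/eqP/colP => j; have /matrixP/(_ i j) := uw0.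
rewrite !mxE big_ord1 !mxE => /eqP; rewrite mulf_eq0 (negbTE ui0) /=.
by rewrite conjc_eq0 => /eqP.
Qed.

Lemma sylv0_det m (Q : 'M[C]_m) : Q \in unitmx -> \det (sylv 0 Q) != 0.
Proof.
move=> uQ; apply/negP => /det0P[x x0]; rewrite -(vec_mxK x) mxvec_sylv.
move/(congr1 vec_mx); rewrite mxvecK linear0 mul0mx sub0r => /eqP.
rewrite oppr_eq0 => /eqP/(congr1 (mulmx^~ (invmx Q))); rewrite mulmxK // mul0mx => e.
by move: x0; rewrite -(vec_mxK x) e linear0 eqxx.
Qed.

End Adjoint.

(** * Functions of two variables of finite rank *)

Section FiniteRank.
Variables (K : fieldType) (T : eqType) (U : Type).
Implicit Types F : T -> U -> K.

(** The functions [F^~ u] span a finite-dimensional space. This replaces polynomials of bounded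
    degree in t: it is stable under sums and products, hence under determinants. *)
Definition frank F : Prop := exists (J : finType) (a : T -> J -> K) (b : J -> U -> K),
  forall t u, F t u = \sum_j a t j * b j u.

Lemma frank_eq F F' : (forall t u, F t u = F' t u) -> frank F -> frank F'.
Proof. by move=> e [J [a [b h]]]; exists J, a, b => t u; rewrite -e. Qed.

Lemma frank_l f : frank (fun t _ => f t).
Proof.
exists unit, (fun t _ => f t), (fun _ _ => 1) => t u.
by rewrite (big_pred1 tt) ?mulr1 //; case.
Qed.

Lemma frank_r f : frank (fun _ u => f u).
Proof.
exists unit, (fun _ _ => 1), (fun _ u => f u) => t u.
by rewrite (big_pred1 tt) ?mul1r //; case.
Qed.

Lemma frankD F F' : frank F -> frank F' -> frank (fun t u => F t u + F' t u).
Proof.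
move=> [J [a [b h]]] [J' [a' [b' h']]].
exists (J + J')%type, (fun t j => match j with inl j => a t j | inr j => a' t j end),
  (fun j u => match j with inl j => b j u | inr j => b' j u end) => t u.
by rewrite h h' big_sumType.
Qed.

Lemma frankM F F' : frank F -> frank F' -> frank (fun t u => F t u * F' t u).
Proof.
move=> [J [a [b h]]] [J' [a' [b' h']]].
exists (J * J')%type, (fun t j => a t j.1 * a' t j.2), (fun j u => b j.1 u * b' j.2 u).
move=> t u; rewrite h h' big_distrlr pair_big /=; apply: eq_bigr => -[i j] _ /=.
by rewrite mulrACA.
Qed.

Lemma frank_sum (I : Type) (s : seq I) (P : pred I) (F : I -> T -> U -> K) :
  (forall i, frank (F i)) -> frank (fun t u => \sum_(i <- s | P i) F i t u).
Proof.
move=> hF; elim: s => [|i s IH].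
  by apply: frank_eq (frank_l (fun=> 0)) => t u; rewrite big_nil.
case Pi: (P i); last by apply: frank_eq IH => t u; rewrite big_cons Pi.
by apply: frank_eq (frankD (hF i) IH) => t u; rewrite big_cons Pi.
Qed.

Lemma frank_prod (I : Type) (s : seq I) (P : pred I) (F : I -> T -> U -> K) :
  (forall i, frank (F i)) -> frank (fun t u => \prod_(i <- s | P i) F i t u).
Proof.
move=> hF; elim: s => [|i s IH].
  by apply: frank_eq (frank_l (fun=> 1)) => t u; rewrite big_nil.
case Pi: (P i); last by apply: frank_eq IH => t u; rewrite big_cons Pi.
by apply: frank_eq (frankM (hF i) IH) => t u; rewrite big_cons Pi.
Qed.

Lemma frank_det m (A : T -> U -> 'M[K]_m) :
  (forall i j, frank (fun t u => A t u i j)) -> frank (fun t u => \det (A t u)).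
Proof.
move=> hA; apply: frank_sum => s; apply: frankM; first exact: frank_l.
by apply: frank_prod => i; exact: hA.
Qed.

(* Gaussian elimination on the coefficients a(t). *)
Lemma frank_finitely_generated F (D : T -> Prop) : frank F ->
  exists2 s : seq T, {in s, forall t, D t} &
    forall u, {in s, forall t, F t u = 0} -> forall t, D t -> F t u = 0.
Proof.
case=> J [a [b h]].
have {h}[d [a' [b' h]]] : exists d (a' : T -> 'I_d -> K) (b' : 'I_d -> U -> K),
    forall t u, F t u = \sum_(j < d) a' t j * b' j u.
  exists #|J|, (fun t j => a t (enum_val j)), (fun j u => b (enum_val j) u) => t u.
  by rewrite h (reindex _ (onW_bij _ (enum_val_bij J))).
elim: d F a' b' h {J a b} => [|d IH] F a b h.
  by exists [::] => // u _ t _; rewrite h big_ord0.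
have [a0|] := pselect (forall t, D t -> a t ord_max = 0).
  have [s sD sP] := IH (fun t u => \sum_(j < d) a t (widen_ord (leqnSn d) j) *
     b (widen_ord (leqnSn d) j) u) _ _ (fun _ _ => erefl).
  have eqF t u : D t -> F t u = \sum_(j < d) a t (widen_ord (leqnSn d) j) *
       b (widen_ord (leqnSn d) j) u.
    by move=> Dt; rewrite h big_ord_recr /= a0 // mul0r addr0.
  exists s => // u su t Dt; rewrite eqF // sP // => t' t's.
  by rewrite -eqF ?su //; exact: sD.
move=> /existsNP[t0 /not_implyP[Dt0 /eqP at0]].
(* Subtracting [c t * F t0 u] removes the last coordinate and changes nothing for those u with
   [F t0 u = 0]; so t0 joins the list. *)
pose c t := a t ord_max / a t0 ord_max.
have [|s sD sP] := IH (fun t u => F t u - c t * F t0 u)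
  (fun t j => a t (widen_ord (leqnSn d) j) - c t * a t0 (widen_ord (leqnSn d) j))
  (fun j u => b (widen_ord (leqnSn d) j) u).
  move=> t u; rewrite !h !big_ord_recr /=.
  under [RHS]eq_bigr do rewrite mulrBl -mulrA.
  rewrite sumrB -mulr_sumr /c; field.
  exact: at0.
exists (t0 :: s) => [t|u su t Dt].
  by rewrite in_cons => /orP[/eqP ->//|/sD].
have F0 : F t0 u = 0 by apply: su; rewrite mem_head.
have := sP u _ t Dt; rewrite F0 mulr0 subr0; apply=> t' t's.
by rewrite mulr0 subr0; apply: su; rewrite in_cons t's orbT.
Qed.

End FiniteRank.

(** Conjugation is not polynomial but preserves finite rank; this admits Gram matrices. *)
Lemma frank_conj (R : realType) (T : eqType) U (F : T -> U -> R[i]) :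
  frank F -> frank (fun t u => conjc (F t u)).
Proof.
case=> J [a [b h]]; exists J, (fun t j => conjc (a t j)), (fun j u => conjc (b j u)).
by move=> t u; rewrite h rmorph_sum; apply: eq_bigr => j _; rewrite rmorphM.
Qed.

(** * The common eigenvalue test for Gram matrices has finite rank *)

Section SylvesterTest.
Variables (R : realType) (n : nat).
Local Notation mat := 'M[R[i]]_(n.+1 + n.+1).

Definition gram (g : mat) := adj (Cblk g) *m Cblk g.

Lemma adj_gram g : adj (gram g) = gram g.
Proof. by rewrite adjM adjK. Qed.

Lemma frank_sylv_gram : frank (fun (g : mat) (u : mat * mat) =>
  \det (sylv (gram (g *m u.1)) (gram (g *m u.2)))).
Proof.
have fC (x : mat * mat -> mat) i j :
    frank (fun (g : mat) u => Cblk (g *m x u) i j).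
  suff : frank (fun (g : mat) u => \sum_k
      (g (rshift n.+1 i) k * x u k (lshift n.+1 j))).
    by apply: frank_eq => g u; rewrite !mxE.
  by apply: frank_sum => k; apply: frankM; [exact: frank_l|exact: frank_r].
have fP (x : mat * mat -> mat) i j :
    frank (fun (g : mat) u => gram (g *m x u) i j).
  suff : frank (fun (g : mat) u => \sum_k
      (conjc (Cblk (g *m x u) k i) * Cblk (g *m x u) k j)).
    by apply: frank_eq => g u; rewrite mxE; apply: eq_bigr => k _; rewrite !mxE.
  by apply: frank_sum => k; apply: frankM => //; apply: frank_conj.
apply: frank_det => ij kl.
(* The entry of [sylv P Q] in row (i, j) and column (k, l) is the (k, l) entry of P X - X Q for the
   matrix unit X = E_ij. *)
case/mxvec_indexP: ij => i j; case/mxvec_indexP: kl => k l.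
pose X : 'M[R[i]]_n.+1 := delta_mx i j.
suff : frank (fun (g : mat) (u : mat * mat) =>
   \sum_p (gram (g *m u.1) k p * X p l) + -1 * \sum_p (X k p * gram (g *m u.2) p l)).
  apply: frank_eq => g u.
  have := mxvec_sylv (gram (g *m u.1)) (gram (g *m u.2)) X.
  move/matrixP/(_ 0 (mxvec_index k l)); rewrite mxvecE.
  rewrite {1}/X mxvec_delta -rowE !mxE => ->; rewrite mulN1r.
  by congr (_ - _).
apply: frankD.
  by apply: frank_sum => p; apply: frankM; [exact: (fP fst)|exact: frank_l].
apply: frankM; first exact: frank_l.
by apply: frank_sum => p; apply: frankM; [exact: frank_l|exact: (fP snd)].
Qed.

End SylvesterTest.

(** * Injective index families as subsets with a permutation *)

Section PluckerIndices.
Variables (n : nat).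
Local Notation N := (n.+1 + n.+1)%N.

Lemma size_enum_pidx (K : pidx n) : size (enum (val K)) = n.+1.
Proof. by rewrite -cardE; exact/eqP/(valP K). Qed.

Lemma pel_in (K : pidx n) i : pel K i \in val K.
Proof. by rewrite -mem_enum mem_nth // size_enum_pidx. Qed.

Lemma pel_inj (K : pidx n) : injective (pel K).
Proof.
move=> i j /eqP; rewrite nth_uniq ?size_enum_pidx ?enum_uniq //.
by move/eqP/val_inj.
Qed.

Lemma pel_onto (K : pidx n) x : x \in val K -> exists i, pel K i = x.
Proof.
rewrite -mem_enum => xK; have lt_x : (index x (enum (val K)) < n.+1)%N.
  by move: xK; rewrite -index_mem size_enum_pidx.
by exists (Ordinal lt_x); rewrite /pel nth_index.
Qed.

Lemma pel_factor (f : 'I_n.+1 -> 'I_N) : injective f ->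
  exists (K : pidx n) (s : 'S_n.+1), forall i, f i = pel K (s i).
Proof.
move=> f_inj; have cardK : #|f @: [set: 'I_n.+1]%SET| == n.+1.
  by rewrite card_imset // cardsT card_ord.
pose K : pidx n := exist _ (f @: [set: 'I_n.+1]%SET) cardK.
have /choice[s sP] : forall i, exists j, pel K j = f i.
  by move=> i; apply: pel_onto; rewrite imset_f.
have s_inj : injective s by move=> i j eq_s; apply: f_inj; rewrite -!sP eq_s.
by exists K, (perm s_inj) => i; rewrite permE sP.
Qed.

Lemma pel_comp_inj (K K' : pidx n) (s s' : 'S_n.+1) :
  (forall i, pel K (s i) = pel K' (s' i)) -> K = K' /\ s = s'.
Proof.
move=> eq_p; have eqK : K = K'.
  apply: val_inj; apply/setP => x; apply/idP/idP => /pel_onto[i <-].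
    by rewrite -(permKV s i) eq_p pel_in.
  by rewrite -(permKV s' i) -eq_p pel_in.
split=> //; apply/permP => i; apply: (@pel_inj K); rewrite eq_p.
by rewrite eqK.
Qed.

End PluckerIndices.

(** * The Cauchy-Binet formula *)

Section CauchyBinet.
Variables (K : comNzRingType) (n : nat).
Local Notation N := (n.+1 + n.+1)%N.

(** Expand over all maps f from rows to columns. A noninjective f gives a minor of X with a repeated
    row; an injective f is uniquely [pel I] after a permutation, and summing over the permutations
    rebuilds the minor of M. *)
Lemma cauchy_binet (M : 'M[K]_(n.+1, N)) (X : 'M[K]_(N, n.+1)) :
  \det (M *m X) = \sum_(I : pidx n)
    \det (\matrix_(i, j) M i (pel I j)) * \det (\matrix_(i, j) X (pel I i) j).
Proof.
pose F := {ffun 'I_n.+1 -> 'I_N}.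
pose G (f : F) := (\prod_i M i (f i)) * \det (\matrix_(i, j) X (f i) j).
transitivity (\sum_(f : F) G f).
  transitivity (\sum_(f : F) \sum_(s : 'S_n.+1)
      (-1) ^+ s * \prod_i (M i (f i) * X (f i) (s i))).
    rewrite exchange_big; apply: eq_bigr => /= s _; rewrite -big_distrr /=.
    congr (_ * _); rewrite -(bigA_distr_bigA (fun i j => M i j * X j (s i))) /=.
    by apply: eq_bigr => i _; rewrite mxE.
  apply: eq_bigr => f _; rewrite /G /determinant mulr_sumr; apply: eq_bigr => s _.
  rewrite big_split /= mulrCA; congr (_ * (_ * _)).
  by apply: eq_bigr => i _; rewrite mxE.
pose h (p : pidx n * 'S_n.+1) : F := [ffun i => pel p.1 (p.2 i)].
have h_inj : injective h.
  move=> [I s] [I' s'] /ffunP eq_h; have [|-> ->//] := @pel_comp_inj _ I I' s s'.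
  by move=> i; have := eq_h i; rewrite !ffunE.
rewrite (bigID (mem (h @: [set: pidx n * 'S_n.+1]%SET))) /= [X in _ + X]big1 ?addr0.
  rewrite big_imset /=; last by move=> p q _ _; exact: h_inj.
  transitivity (\sum_(p : pidx n * 'S_n.+1) G (h p)).
    by apply: eq_bigl => p; rewrite inE.
  rewrite -(pair_bigA _ (fun I s => G (h (I, s)))) /=; apply: eq_bigr => I _.
  rewrite [X in _ = X * _]/determinant mulr_suml; apply: eq_bigr => s _.
  rewrite /G; set A := \matrix_(i, j) X (pel I i) j.
  have -> : \matrix_(i, j) X (h (I, s) i) j = row_perm s A.
    by apply/matrixP => i j; rewrite !mxE ffunE.
  rewrite row_permE det_mulmx det_perm mulrA; congr (_ * _).
  rewrite mulrC; congr (_ * _); apply: eq_bigr => i _.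
  by rewrite ffunE mxE.
move=> f f_notin; rewrite /G; suff -> : \det (\matrix_(i, j) X (f i) j) = 0.
  by rewrite mulr0.
have /existsNP[i /existsNP[j /not_implyP[eq_f /eqP ne_ij]]] : ~ injective f.
  move=> /pel_factor[I [s fE]]; move/negP: f_notin; apply; apply/imsetP.
  exists (I, s); first by rewrite inE.
  by apply/ffunP => i; rewrite ffunE.
by apply: (determinant_alternate ne_ij) => k; rewrite !mxE eq_f.
Qed.

End CauchyBinet.

(** * Plücker coordinates and the compound matrix *)

Section Compound.
Variables (R : realType) (n : nat).
Local Notation C := R[i].
Local Notation N := (n.+1 + n.+1)%N.
Local Notation mat := 'M[C]_N.
Implicit Types (g h : mat) (A : 'M[C]_(N, n.+1)) (I J : pidx n).

Lemma plucker_mul g A I :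
  plucker (g *m A) I = \sum_J compound g I J * plucker A J.
Proof.
rewrite /plucker /compound.
transitivity (\det ((\matrix_(i < n.+1, j < N) g (pel I i) j) *m A)).
  by congr (\det _); apply/matrixP => i j; rewrite !mxE; apply: eq_bigr => k _; rewrite mxE.
rewrite cauchy_binet; apply: eq_bigr => J _; congr (\det _ * _).
by apply/matrixP => i j; rewrite !mxE.
Qed.

Lemma compoundE g I J : compound g I J = plucker (\matrix_(i, j) g i (pel J j)) I.
Proof. by congr (\det _); apply/matrixP => i j; rewrite !mxE. Qed.

Lemma compound_mul g h I J :
  compound (g *m h) I J = \sum_K compound g I K * compound h K J.
Proof.
rewrite compoundE.
have -> : \matrix_(i, j) (g *m h) i (pel J j) = g *m (\matrix_(i, j) h i (pel J j)).
  by apply/matrixP => i j; rewrite !mxE; apply: eq_bigr => k _; rewrite mxE.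
by rewrite plucker_mul; apply: eq_bigr => K _; rewrite -compoundE.
Qed.

Lemma plucker_mulr A (M : 'M[C]_n.+1) I : plucker (A *m M) I = plucker A I * \det M.
Proof.
rewrite /plucker -det_mulmx; congr (\det _); apply/matrixP => i j.
by rewrite !mxE; apply: eq_bigr => k _; rewrite mxE.
Qed.

(* A form linear in each column and bounded by k on a box of radius e around X0
   is bounded by (2/e)^(n+1) k on the unit box: y = ((x0 + e y) - x0) / e. *)
Lemma plucker_box_bound g I (X0 : 'M[C]_(N, n.+1)) (e k : R) : 0 < e ->
  (forall X : 'M[C]_(N, n.+1), (forall i j, cabs (X i j - X0 i j) <= e) -> cabs (plucker (g *m X) I) <= k) ->
  forall X : 'M[C]_(N, n.+1), (forall i j, cabs (X i j) <= 1) ->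
  cabs (plucker (g *m X) I) <= (2 / e) ^+ n.+1 * k.
Proof.
move=> e0 box X X1.
(* Induction on the number m of columns already released from the small box to the unit box; each
   release costs a factor 2/e. *)
suff claim m : (m <= n.+1)%N -> forall X : 'M[C]_(N, n.+1),
    (forall i (j : 'I_n.+1), if (j < m)%N then cabs (X i j) <= 1 else cabs (X i j - X0 i j) <= e) ->
    cabs (plucker (g *m X) I) <= (2 / e) ^+ m * k.
  by apply: (claim n.+1 (leqnn _)) => i j; rewrite ltn_ord X1.
elim: m => [_ Y Yb|m IH lt_m Y Yb]; first by rewrite expr0 mul1r; apply: box => i j; exact: Yb.
pose j0 := Ordinal lt_m; pose ec : C := e%:C%C.
have ec0 : ec != 0 by rewrite -cabs_eq0 cabsR normr_eq0 gt_eqF.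
pose U (t : C) : 'M[C]_(N, n.+1) :=
  \matrix_(i, j) if j == j0 then X0 i j + t * Y i j else Y i j.
have Ub t : cabs t <= e -> cabs (plucker (g *m U t) I) <= (2 / e) ^+ m * k.
  move=> te; apply: (IH (ltnW lt_m)) => i j; have := Yb i j; rewrite !mxE.
  have [->|ne_j] := eqVneq j j0.
    rewrite ltnS leqnn ltnn addrC addKr cabsM => Y1.
    apply: le_trans te; rewrite -[leRHS]mulr1.
    by rewrite ler_wpM2l ?cabs_ge0.
  rewrite ltnS leq_eqVlt; have -> : (j == m :> nat) = false by exact: negbTE.
  by [].
have -> : plucker (g *m Y) I = ec^-1 * plucker (g *m U ec) I - ec^-1 * plucker (g *m U 0) I.
  rewrite /plucker -det_tr -[\det (\matrix_(i, j) (g *m U ec) _ _)]det_tr.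
  rewrite -[\det (\matrix_(i, j) (g *m U 0) _ _)]det_tr -mulNr.
  apply: (@determinant_multilinear _ _ _ _ _ j0).
  - apply/rowP => i; rewrite !mxE !mulr_sumr -big_split /=; apply: eq_bigr => l _.
    by rewrite !mxE eqxx; field.
  - apply/matrixP => i j; rewrite !mxE; apply: eq_bigr => l _; rewrite !mxE.
    by rewrite eq_sym (negbTE (neq_lift _ _)).
  - apply/matrixP => i j; rewrite !mxE; apply: eq_bigr => l _; rewrite !mxE.
    by rewrite eq_sym (negbTE (neq_lift _ _)).
apply: le_trans (cabsD _ _) _; rewrite cabsN !cabsM cabsV cabsR (gtr0_norm e0).
have ie : 0 <= e^-1 by rewrite invr_ge0 ltW.
have Ue : cabs (plucker (g *m U ec) I) <= (2 / e) ^+ m * k.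
  by apply: Ub; rewrite cabsR gtr0_norm.
have U0 : cabs (plucker (g *m U 0) I) <= (2 / e) ^+ m * k.
  by apply: Ub; rewrite cabs0 ltW.
rewrite exprS -mulrA; move: (_ ^+ m * k) Ue U0 => M.
move: (cabs (plucker (g *m U ec) I)) (cabs (plucker (g *m U 0) I)) => a b Ue U0.
have -> : 2 / e * M = e^-1 * M + e^-1 * M by ring.
by apply: lerD; rewrite ler_wpM2l.
Qed.

(** Columns of the compound matrix are Plücker vectors of images of coordinate planes, whose 0-1
    matrices lie in the unit box. *)
Lemma compound_box_bound g (X0 : 'M[C]_(N, n.+1)) (e k : R) : 0 < e ->
  (forall I (X : 'M[C]_(N, n.+1)), (forall i j, cabs (X i j - X0 i j) <= e) ->
    cabs (plucker (g *m X) I) <= k) ->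
  forall I J, cabs (compound g I J) <= (2 / e) ^+ n.+1 * k.
Proof.
move=> e0 box I J; rewrite compoundE.
have -> : \matrix_(i, j) g i (pel J j) = g *m (\matrix_(i, j) (i == pel J j)%:R).
  apply/matrixP => i j; rewrite !mxE (bigD1 (pel J j)) //= !mxE eqxx mulr1.
  rewrite big1 ?addr0 // => k' ne; rewrite mxE (negbTE ne) mulr0 //.
apply: (plucker_box_bound e0 (box I)) => i j; rewrite mxE.
by case: (_ == _); rewrite ?cabs1 ?cabs0.
Qed.

(** The plane {z'' = 0} is a coordinate plane, so its image has one column of the compound matrix as
    Plücker vector, up to the sign [c] of a reordering of indices. *)
Lemma compound_lsubmx : exists (J : pidx n) (c : C),
  c != 0 /\ forall g I, plucker (lsubmx g) I = compound g I J * c.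
Proof.
have [J [s sP]] := pel_factor (@lshift_inj n.+1 n.+1).
exists J, ((-1) ^+ s); split; first by rewrite signr_eq0.
move=> g I; rewrite -odd_permV -det_perm /compound -det_mulmx; congr (\det _).
rewrite -col_permE.
by apply/matrixP => i j; rewrite !mxE sP.
Qed.

Lemma plucker_dsubmx : exists (J : pidx n) (c : C),
  c != 0 /\ forall A, \det (dsubmx A) = c * plucker A J.
Proof.
have [J [s sP]] := pel_factor (@rshift_inj n.+1 n.+1).
exists J, ((-1) ^+ s); split; first by rewrite signr_eq0.
move=> A; rewrite -det_perm /plucker -det_mulmx; congr (\det _).
rewrite -row_permE.
by apply/matrixP => i j; rewrite !mxE sP.
Qed.

End Compound.

(** * Block calculus and equality in PGL *)

Section Blocks.
Variables (R : realType) (n : nat).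
Local Notation C := R[i].
Local Notation N := (n.+1 + n.+1)%N.
Local Notation mat := 'M[C]_N.
Implicit Types (g h : mat).

Lemma usubmx_mul g p (X : 'M[C]_(N, p)) :
  usubmx (g *m X) = ulsubmx g *m usubmx X + ursubmx g *m dsubmx X.
Proof.
by rewrite -{1}(submxK g) -{1}(vsubmxK X) mul_block_col col_mxKu.
Qed.

Lemma dsubmx_mul g p (X : 'M[C]_(N, p)) :
  dsubmx (g *m X) = Cblk g *m usubmx X + Dblk g *m dsubmx X.
Proof.
by rewrite -{1}(submxK g) -{1}(vsubmxK X) mul_block_col col_mxKd.
Qed.

Lemma Cblk_mul g h : Cblk (g *m h) = Cblk g *m ulsubmx h + Dblk g *m Cblk h.
Proof.
by rewrite -{1}(submxK g) -{1}(submxK h) mulmx_block /Cblk block_mxKdl.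
Qed.

Lemma Cblk1 : Cblk (1%:M : mat) = 0.
Proof. by rewrite scalar_mx_block /Cblk block_mxKdl. Qed.

Lemma is_scalarV g : g \in unitmx -> is_scalar (invmx g) -> is_scalar g.
Proof.
move=> ug [a ea]; exists a^-1; rewrite -(invmxK g) ea.
by rewrite invmx_scalar.
Qed.

Lemma proj_eq_of_scalar g h : g \in unitmx -> h \in unitmx ->
  is_scalar (invmx g *m h) -> proj_eq h g.
Proof.
move=> ug uh [a ea]; exists a.
have eh : h = a *: g by rewrite -(mulKVmx ug h) ea mul_mx_scalar.
split=> //; apply: contraTneq uh => a0.
by rewrite eh a0 scale0r unitmxE det0 unitr0.
Qed.

Lemma proj_eq_sym g h : proj_eq g h -> proj_eq h g.
Proof.
case=> a [a0 ->]; exists a^-1; split; first by rewrite invr_eq0.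
by rewrite scalerA mulVf // scale1r.
Qed.

Lemma unitmx_neq0 g : g \in unitmx -> exists i j, g i j != 0.
Proof.
move=> ug; apply: contrapT => h; move: ug; have -> : g = 0.
  apply/matrixP => i j; rewrite mxE; apply/eqP/negPn/negP => gij.
  by apply: h; exists i, j.
by rewrite unitmxE det0 unitr0.
Qed.

End Blocks.

(** * Bounds on the blocks of g from the disjointness of V_R and its translate *)

Section Translates.
Variables (R : realType) (n : nat).
Local Notation C := R[i].
Local Notation N := (n.+1 + n.+1)%N.
Local Notation mat := 'M[C]_N.
Variables (G : set mat) (r : R).
Hypothesis Ggrp : pgl_subgroup G.
Hypothesis r0 : 0 < r.
Hypothesis disj : forall g, G g -> ~ is_scalar g ->
  pt_image g (V_R r) `&` V_R r = set0.
Implicit Types (g h : mat).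

Let Gunit g : G g -> g \in unitmx.
Proof. by case: Ggrp => + _ _ _ _; apply. Qed.
Let Gmul g h : G g -> G h -> G (g *m h).
Proof. by case: Ggrp => _ _ + _ _; apply. Qed.
Let Ginv g : G g -> G (invmx g).
Proof. by case: Ggrp => _ _ _ + _; apply. Qed.

Let nonscalarV g : G g -> ~ is_scalar g -> ~ is_scalar (invmx g).
Proof. by move=> /Gunit ug ns /(is_scalarV ug). Qed.

Lemma image_V_R g z : G g -> ~ is_scalar g -> V_R r z ->
  vnorm (zp (g *m z)) <= r * vnorm (zpp (g *m z)) /\ zpp (g *m z) != 0.
Proof.
move=> Gg ns Vz; have gz0 : g *m z != 0.
  apply: contraNneq Vz.1 => /(congr1 (mulmx (invmx g))).
  by rewrite mulKmx ?Gunit // mulmx0 => ->.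
have le_gz : vnorm (zp (g *m z)) <= r * vnorm (zpp (g *m z)).
  rewrite leNgt; apply/negP => lt_gz.
  have : (pt_image g (V_R r) `&` V_R r) (g *m z) by split=> //; exists z.
  by rewrite disj.
split=> //; apply: contraNneq gz0 => zpp0; move: le_gz.
rewrite zpp0 vnorm0 mulr0 => le0; have : zp (g *m z) == 0.
  by rewrite -vnorm_eq0 eq_le le0 vnorm_ge0.
move=> /eqP zp0; rewrite -(vsubmxK (g *m z)).
by move: zp0 zpp0; rewrite /zp /zpp => -> ->; rewrite col_mx0.
Qed.

Lemma V_R_horizontal (x : 'cV[C]_n.+1) : x != 0 -> V_R r (col_mx x 0).
Proof.
move=> x0; split.
  by rewrite col_mx_eq0 (negbTE x0).
by rewrite /zp /zpp col_mxKu col_mxKd vnorm0 mulr0 vnorm_gt0.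
Qed.

Lemma unit_of_inj m (A : 'M[C]_m) : (forall v : 'cV_m, A *m v = 0 -> v = 0) ->
  A \in unitmx.
Proof.
move=> inj; rewrite unitmxE unitfE -det_tr; apply/negP => /det0P[v v0].
move/(congr1 trmx); rewrite trmx_mul trmxK trmx0 => /inj vt0.
by move: v0; rewrite -(trmxK v) vt0 trmx0 eqxx.
Qed.

(** If C x = 0, then g maps the point (x, 0) of V_R back into {z'' = 0}. *)
Lemma Cblk_unit g : G g -> ~ is_scalar g -> Cblk g \in unitmx.
Proof.
move=> Gg ns; apply: unit_of_inj => x Cx0; apply/eqP/negPn/negP => x0.
have [_] := image_V_R Gg ns (V_R_horizontal x0).
by rewrite /zpp dsubmx_mul col_mxKu col_mxKd mulmx0 addr0 Cx0 eqxx.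
Qed.

(** The image of {z'' = 0} under g is the graph z' = a_g z''; its preimage is z' = - b_g z''. *)
Definition a_mx g : 'M[C]_n.+1 := ulsubmx g *m invmx (Cblk g).
Definition b_mx g : 'M[C]_n.+1 := invmx (Cblk g) *m Dblk g.

Lemma a_mx_le g v : G g -> ~ is_scalar g -> vnorm (a_mx g *m v) <= r * vnorm v.
Proof.
move=> Gg ns; have uC := Cblk_unit Gg ns.
have [->|v0] := eqVneq v 0; first by rewrite mulmx0 !vnorm0 mulr0.
have w0 : invmx (Cblk g) *m v != 0.
  by apply: contraNneq v0 => /(congr1 (mulmx (Cblk g))); rewrite mulKVmx // mulmx0 => ->.
have [+ _] := image_V_R Gg ns (V_R_horizontal w0).
rewrite /zp /zpp usubmx_mul dsubmx_mul col_mxKu col_mxKd !mulmx0 !addr0.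
by rewrite mulKVmx // mulmxA.
Qed.

(** If the bound failed at v, the point (- b_g v, v) would lie in V_R, yet g sends it into {z'' =
    0}. *)
Lemma b_mx_le g v : G g -> ~ is_scalar g -> vnorm (b_mx g *m v) <= r * vnorm v.
Proof.
move=> Gg ns; have uC := Cblk_unit Gg ns; rewrite leNgt; apply/negP => lt_v.
have Vz : V_R r (col_mx (- (b_mx g *m v)) v).
  split; last by rewrite /zp /zpp col_mxKu col_mxKd vnormN.
  rewrite col_mx_eq0 oppr_eq0 -vnorm_eq0 gt_eqF //.
  by apply: le_lt_trans lt_v; rewrite mulr_ge0 ?vnorm_ge0 // ltW.
have [_] := image_V_R Gg ns Vz.
rewrite /zpp dsubmx_mul col_mxKu col_mxKd mulmxN /b_mx -mulmxA mulKVmx //.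
by rewrite addNr eqxx.
Qed.

(** Read off from the lower left block of [g *m invmx g], which vanishes. *)
Lemma a_mx_inv g : G g -> ~ is_scalar g -> a_mx (invmx g) = - b_mx g.
Proof.
move=> Gg ns; have uC := Cblk_unit Gg ns.
have uC' := Cblk_unit (Ginv Gg) (nonscalarV Gg ns).
have := Cblk_mul g (invmx g); rewrite mulmxV ?Gunit // Cblk1.
move/(congr1 (fun X => invmx (Cblk g) *m X *m invmx (Cblk (invmx g)))).
rewrite mulmx0 mul0mx mulmxDr mulKmx // mulmxDl => /esym/eqP.
by rewrite addr_eq0 mulmxA mulmxK // => /eqP.
Qed.

Lemma dsubmx_mul_b g p (X : 'M[C]_(N, p)) : G g -> ~ is_scalar g ->
  dsubmx (g *m X) = Cblk g *m (usubmx X + b_mx g *m dsubmx X).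
Proof.
move=> Gg ns; rewrite dsubmx_mul mulmxDr /b_mx -mulmxA mulKVmx //.
exact: Cblk_unit.
Qed.

Lemma zpp_mul_a g y : G g -> ~ is_scalar g ->
  zpp (g *m y) = Cblk g *m (zp y - a_mx (invmx g) *m zpp y).
Proof. by move=> Gg ns; rewrite a_mx_inv // mulNmx opprK /zpp dsubmx_mul_b. Qed.

Lemma lsubmx_graph g : G g -> ~ is_scalar g ->
  lsubmx g = col_mx (a_mx g) 1%:M *m Cblk g.
Proof.
move=> Gg ns; rewrite mul_col_mx mul1mx /a_mx mulmxKV ?Cblk_unit //.
rewrite -[LHS]vsubmxK; by congr col_mx; apply/matrixP => i j; rewrite !mxE.
Qed.

(* All n-planes near {z'' = 0} lie in V_R, so their images are graphs z' = a z''
   with |a| <= r; this bounds the compound matrix on a box. *)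
Lemma compound_le : exists2 K : R, 0 < K & forall g, G g -> ~ is_scalar g ->
  forall I J, cabs (compound g I J) <= K * cabs (\det (Cblk g)).
Proof.
pose q : R := n.+1%:R; have q0 : 0 < q by rewrite ltr0n.
pose m : R := q * q; have m0 : 0 < m by rewrite mulr_gt0.
(* A matrix of size n+1 with entries at most e has norm at most m e. Here m e (1 + r) = 1/2, so |P
   x| >= (1 - m e)|x| still exceeds r |Q x| and every plane in the box stays in V_R. *)
pose e : R := (2 * m * (1 + r))^-1.
have r1 : 0 < 1 + r by rewrite addr_gt0.
have den0 : 0 < 2 * m * (1 + r) by rewrite !mulr_gt0.
have e0 : 0 < e by rewrite invr_gt0.
have {den0} em : r * (m * e) < 1 - m * e.
  have -> : m * e = (2 * (1 + r))^-1 by rewrite /e; field; rewrite !gt_eqF.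
  rewrite ltrBrDr -[X in _ + X]mul1r -mulrDl addrC ltr_pdivrMr ?mulr_gt0 //.
  by rewrite mul1r ltr_pMl // ltr1n.
pose X0 : 'M[C]_(N, n.+1) := col_mx 1%:M 0.
(* [k1] bounds the minors of the graph matrix of a, whose entries are at most 1 + r, and [k2] bounds
   the determinant of P + b_g Q. *)
pose k1 : R := (factorial n.+1)%:R * (1 + r) ^+ n.+1.
pose k2 : R := (factorial n.+1)%:R * (1 + e + q * (r * e)) ^+ n.+1.
have k10 : 0 < k1 by rewrite mulr_gt0 ?ltr0n ?fact_gt0 // exprn_gt0.
have k20 : 0 < k2.
  by rewrite mulr_gt0 ?ltr0n ?fact_gt0 // exprn_gt0 // !addr_gt0 // !mulr_gt0.
exists ((2 / e) ^+ n.+1 * (k1 * k2)).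
  by apply: mulr_gt0; [rewrite exprn_gt0 // divr_gt0|exact: mulr_gt0].
move=> g Gg ns I0 J0; rewrite -mulrA.
apply: (@compound_box_bound _ _ _ X0 e _ e0) => {I0 J0} I X Xb.
pose P := usubmx X; pose Q := dsubmx X.
have Pb i j : cabs ((P - 1%:M) i j) <= e.
  by have := Xb (lshift _ i) j; rewrite /P /X0 col_mxEu !mxE.
have Qb i j : cabs (Q i j) <= e.
  by have := Xb (rshift _ i) j; rewrite /Q /X0 col_mxEd !mxE subr0.
have small (M : 'M[C]_n.+1) x : (forall i j, cabs (M i j) <= e) ->
    vnorm (M *m x) <= m * e * vnorm x.
  move=> Mb; apply: le_trans (vnorm_mulmx_le _ _) _.
  rewrite ler_wpM2r ?vnorm_ge0 //.
  have -> : m * e = \sum_(i < n.+1) \sum_(j < n.+1) e.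
    by rewrite !sumr_const !card_ord -mulrnA -mulr_natl natrM.
  by apply: ler_sum => i _; apply: ler_sum => j _.
have VX x : x != 0 -> V_R r (X *m x).
  move=> x0; have vx0 : 0 < vnorm x by rewrite vnorm_gt0.
  have zpE : zp (X *m x) = P *m x by rewrite /zp -mul_usub_mx.
  have zppE : zpp (X *m x) = Q *m x by rewrite /zpp -mul_dsub_mx.
  have lt_z : r * vnorm (zpp (X *m x)) < vnorm (zp (X *m x)).
    have ge_P : (1 - m * e) * vnorm x <= vnorm (P *m x).
      have -> : P *m x = x - (- ((P - 1%:M) *m x)) by rewrite opprK mulmxBl mul1mx addrC subrK.
      apply: le_trans (vnorm_subr_le _ _); rewrite vnormN mulrBl mul1r lerD2l lerN2.
      exact: small.
    rewrite zpE zppE; apply: lt_le_trans ge_P; apply: le_lt_trans (_ : _ <= r * (m * e) * vnorm x) _.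
      by rewrite -mulrA ler_wpM2l ?small // ltW.
    by rewrite ltr_pM2r.
  split=> //; apply: contraTneq lt_z => ->.
  by rewrite /zp /zpp !linear0 !vnorm0 mulr0 ltxx.
pose Y := dsubmx (g *m X).
have uY : Y \in unitmx.
  apply: unit_of_inj => x Yx0; apply/eqP/negPn/negP => x0.
  have [_] := image_V_R Gg ns (VX x x0).
  by rewrite mulmxA /zpp -mul_dsub_mx -/Y Yx0 eqxx.
pose a := usubmx (g *m X) *m invmx Y.
have ale v : vnorm (a *m v) <= r * vnorm v.
  have [->|v0] := eqVneq v 0; first by rewrite mulmx0 !vnorm0 mulr0.
  have x0 : invmx Y *m v != 0.
    by apply: contraNneq v0 => /(congr1 (mulmx Y)); rewrite mulKVmx // mulmx0 => ->.
  have [+ _] := image_V_R Gg ns (VX _ x0).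
  rewrite mulmxA /zp /zpp -mul_usub_mx -mul_dsub_mx -/Y mulKVmx //.
  by rewrite mulmxA.
have -> : g *m X = col_mx a 1%:M *m Y.
  by rewrite mul_col_mx mul1mx mulmxKV // vsubmxK.
rewrite plucker_mulr cabsM /Y dsubmx_mul_b // det_mulmx cabsM -/P -/Q.
rewrite mulrCA mulrC ler_wpM2r ?cabs_ge0 //.
apply: ler_pM; rewrite ?cabs_ge0 //.
  apply: cabs_det_le => [|i j]; first exact: ltW.
  rewrite mxE; case: (split_ordP (pel I i)) => l ->.
    by rewrite col_mxEu; apply: le_trans (entry_le_of_vnorm ale _ _) _; rewrite lerDr.
  rewrite col_mxEd mxE; case: (_ == _); rewrite ?cabs1 ?cabs0; last exact: ltW.
  by rewrite lerDl ltW.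
have b_le i j := entry_le_of_vnorm (fun v => b_mx_le v Gg ns) i j.
apply: cabs_det_le => [|i j]; first by rewrite !addr_ge0 ?mulr_ge0 ?(ltW e0) ?(ltW q0) ?(ltW r0).
rewrite mxE; apply: le_trans (cabsD _ _) _; apply: lerD.
  have -> : P = 1%:M + (P - 1%:M) by rewrite addrC subrK.
  rewrite mxE; apply: le_trans (cabsD _ _) _; apply: lerD => //.
  by rewrite mxE; case: (_ == _); rewrite ?cabs1 ?cabs0.
rewrite mxE; apply: le_trans (cabs_sum _ _ _) _.
have -> : q * (r * e) = \sum_(l < n.+1) r * e by rewrite sumr_const card_ord mulr_natl.
by apply: ler_sum => l _; rewrite cabsM; apply: ler_pM; rewrite ?cabs_ge0.
Qed.

End Translates.

(** * Limit n-planes: invariance, and graphs as limits *)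

Section LimitPlanes.
Variables (R : realType) (n : nat).
Local Notation C := R[i].
Local Notation N := (n.+1 + n.+1)%N.
Local Notation mat := 'M[C]_N.
Variables (G : set mat).
Hypothesis Ggrp : pgl_subgroup G.

Let Gunit g : G g -> g \in unitmx.
Proof. by case: Ggrp => + _ _ _ _; apply. Qed.

(** Normalized entries are bounded by 1. Both families are indexed by one disjoint sum, so a single
    extraction serves them. *)
Lemma normal_extract (s : nat -> mat) :
  (forall k, G (s k)) -> (forall k l, k <> l -> ~ proj_eq (s k) (s l)) ->
  (forall k, exists I J, compound (s k) I J != 0) ->
  exists2 phi, increasing phi & exists T Th, normal_seq G (s \o phi) T Th.
Proof.
move=> Gs dist nz.
have /choice[lam lamP] : forall k, exists a : C,
    a != 0 /\ normalized (fun i j => a * s k i j).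
  move=> k; have [a] := normalize (unitmx_neq0 (Gunit (Gs k))).
  by exists a.
have /choice[kap kapP] : forall k, exists a : C,
    a != 0 /\ normalized (fun I J => a * compound (s k) I J).
  by move=> k; have [a] := normalize (nz k); exists a.
pose u k (x : 'I_N * 'I_N + pidx n * pidx n) := match x with
  | inl p => lam k * s k p.1 p.2 | inr p => kap k * compound (s k) p.1 p.2 end.
have [k x|phi inc [l lP]] := @cvc_extract_fin _ _ u 1.
  by case: x => p /=; [exact: (lamP k).2.1|exact: (kapP k).2.1].
exists phi => //; exists (fun i j => l (inl (i, j))), (fun I J => l (inr (I, J))).
split=> [k|k k' ne||] /=; first exact: Gs.
- by apply: dist => /(increasing_inj inc).
- exists (lam \o phi); split=> [k|e e0]; first exact: lamP.
  have [k0 h] := cvc_unif lP e0; exists k0 => k /h hk i j.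
  exact: (hk (inl (i, j))).
- exists (kap \o phi); split=> [k|e e0]; first exact: kapP.
  have [k0 h] := cvc_unif lP e0; exists k0 => k /h hk I J.
  exact: (hk (inr (I, J))).
Qed.

(** The translated sequence needs its own normalization and extraction, but its limit is still
    proportional to [compound h] times the old limit. *)
Lemma limit_nplane_mul h A : G h -> limit_nplane G A -> limit_nplane G (h *m A).
Proof.
move=> Gh [rkA [s [T [Th [[Gs dist cvT cvTh] [v vP]]]]]].
have uh := Gunit Gh.
split.
  have fh : row_full h by rewrite row_full_unit.
  by rewrite /nplane (eqmxMfull A fh).
pose t k := h *m s k.
have sE k I J : compound (s k) I J = \sum_K compound (invmx h) I K * compound (t k) K J.
  by rewrite -compound_mul /t mulKmx.
have [kap [kapP kapcv]] := nconv_cvc cvTh.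
have tnz k : exists I J, compound (t k) I J != 0.
  apply: contrapT => h0; have [_ [_ [I [J]]]] := kapP k.
  rewrite sE big1 ?mulr0 ?cabs0 => [/eqP|K _]; first by rewrite eq_sym oner_eq0.
  have [->|nz] := eqVneq (compound (t k) K J) 0; first by rewrite mulr0.
  by case: h0; exists K, J.
have Gt k : G (t k) by case: Ggrp => _ _ Gm _ _; apply: Gm.
have tdist k l : k <> l -> ~ proj_eq (t k) (t l).
  move=> /dist ne [a [a0]]; rewrite /t scalemxAr => /(congr1 (mulmx (invmx h))).
  by rewrite !mulKmx // => e; apply: ne; exists a.
have [phi inc [T' [Th' norm]]] := normal_extract Gt tdist tnz.
exists (t \o phi), T', Th'; split=> //; case: norm => _ _ _ cvTh'.
have [kap' [kapP' kapcv']] := nconv_cvc cvTh'.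
pose W I J := \sum_K compound h I K * Th K J.
have Wcv I J : cvc (fun k => kap (phi k) * compound (t (phi k)) I J) (W I J).
  apply: (@cvc_eq _ (fun k => \sum_K compound h I K * (kap (phi k) * compound (s (phi k)) K J))).
    by move=> k; rewrite compound_mul mulr_sumr; apply: eq_bigr => K _; rewrite mulrCA.
  apply: (@cvc_sum _ _ _ xpredT (fun k K => compound h I K * (kap (phi k) * compound (s (phi k)) K J))
    (fun K => compound h I K * Th K J)) => K.
  by apply: cvcM; [exact: cvc_cst|exact: (cvc_subseq inc (kapcv K J))].
(* Undoing h in the limit shows that W is not 0. *)
have WTh I J : Th I J = \sum_K compound (invmx h) I K * W K J.
  apply: cvc_unique (cvc_subseq inc (kapcv I J)) _.
  apply: (@cvc_eq _ (fun k => \sum_K compound (invmx h) I K *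
      (kap (phi k) * compound (t (phi k)) K J))).
    by move=> k /=; rewrite sE mulr_sumr; apply: eq_bigr => K _; rewrite mulrCA.
  apply: (@cvc_sum _ _ _ xpredT (fun k K => compound (invmx h) I K *
      (kap (phi k) * compound (t (phi k)) K J))
    (fun K => compound (invmx h) I K * W K J)) => K.
  by apply: cvcM; [exact: cvc_cst|exact: Wcv].
(* Th' and W are limits of scalar multiples of the same compounds, hence proportional. *)
have cross I J I' J' : Th' I J * W I' J' = Th' I' J' * W I J.
  apply: cvc_unique (cvcM (kapcv' I J) (Wcv I' J')) _.
  apply: cvc_eq (cvcM (kapcv' I' J') (Wcv I J)) => k /=.
  by rewrite mulrACA [RHS]mulrACA; congr (_ * _); rewrite mulrC.
have [I1 [J1 W1]] : exists I J, W I J != 0.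
  apply: contrapT => h0; have [I [J /eqP]] := nconv_neq0 cvTh; apply.
  rewrite WTh big1 // => K _; have [->|nz] := eqVneq (W K J) 0; first by rewrite mulr0.
  by case: h0; exists K, J.
have [I2 [J2 Th2]] := nconv_neq0 cvTh'.
pose c := Th' I1 J1 / W I1 J1.
have Th'E I J : Th' I J = c * W I J.
  by rewrite /c mulrAC -cross mulfK.
have c0 : c != 0 by apply: contraNneq Th2 => c0; rewrite Th'E c0 mul0r.
exists (fun J => v J / c) => I; rewrite plucker_mul.
transitivity (\sum_J W I J * v J).
  under eq_bigr do rewrite vP mulr_sumr.
  rewrite exchange_big; apply: eq_bigr => J _ /=; rewrite /W mulr_suml.
  by apply: eq_bigr => K _; rewrite mulrA.
by apply: eq_bigr => J _; rewrite Th'E mulrAC [c * _]mulrC; field.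
Qed.

Lemma Omega_mul g z : G g -> Omega G z -> Omega G (g *m z).
Proof.
move=> Gg [z0 nz]; have ug := Gunit Gg.
have Gi : G (invmx g) by case: Ggrp => _ _ _ + _; apply.
split.
  apply: contraNneq z0 => /(congr1 (mulmx (invmx g))).
  by rewrite mulKmx // mulmx0 => ->.
move=> [A [limA [_ [c eqc]]]]; apply: nz; exists (invmx g *m A).
split; first exact: limit_nplane_mul.
by split=> //; exists c; rewrite -mulmxA -eqc mulKmx.
Qed.

Variable r : R.
Hypothesis r0 : 0 < r.
Hypothesis disj : forall g, G g -> ~ is_scalar g ->
  pt_image g (V_R r) `&` V_R r = set0.

(* The Pluecker point of the graph of a is a column of the limit compound matrix:
   g({z'' = 0}) is the graph of a_g, with Pluecker norm comparable to det C_g. *)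
Lemma limit_nplane_graph (s : nat -> mat) (a : 'M[C]_n.+1) :
  (forall k, G (s k)) -> (forall k, ~ is_scalar (s k)) ->
  (forall k l, k <> l -> ~ proj_eq (s k) (s l)) ->
  (forall i j, cvc (fun k => a_mx (s k) i j) (a i j)) ->
  limit_nplane G (col_mx a 1%:M).
Proof.
move=> Gs ns dist acv.
have [J0 [c0 [c00 c0P]]] := compound_lsubmx R n.
have [I1 [c1 [c10 c1P]]] := plucker_dsubmx R n.
pose gr (M : 'M[C]_n.+1) : 'M[C]_(N, n.+1) := col_mx M 1%:M.
have colE g I : G g -> ~ is_scalar g ->
    plucker (gr (a_mx g)) I * \det (Cblk g) = compound g I J0 * c0.
  move=> Gg nsg; rewrite -c0P -plucker_mulr /gr -(lsubmx_graph Ggrp disj Gg nsg) //.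
have grI1 M : c1 * plucker (gr M) I1 = 1.
  by rewrite -c1P /gr col_mxKd det1.
split.
  apply/eqP; rewrite eqn_leq rank_leq_col /=.
  rewrite -[X in (X <= _)%N](mxrank1 C n.+1); apply: mxrankS.
  by rewrite -addsmxE addsmxSr.
have nz k : exists I J, compound (s k) I J != 0.
  exists I1, J0; have dC : \det (Cblk (s k)) != 0.
    by rewrite -unitfE -unitmxE (Cblk_unit Ggrp disj).
  apply: contraNneq dC => e; have := colE _ I1 (Gs k) (ns k).
  rewrite e mul0r => /eqP; rewrite mulf_eq0 => /orP[/eqP p0|//].
  by have := grI1 (a_mx (s k)); rewrite p0 mulr0 => /eqP; rewrite eq_sym oner_eq0.
have [phi inc [T [Th norm]]] := normal_extract Gs dist nz.
exists (s \o phi), T, Th; split=> //; case: norm => _ _ _ cvTh.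
have [kap [kapP kapcv]] := nconv_cvc cvTh.
pose mu k := kap k * \det (Cblk (s (phi k))).
have cvcol I : cvc (fun k => plucker (gr (a_mx (s (phi k)))) I * mu k) (Th I J0 * c0).
  apply: cvc_eq (cvcM (kapcv I J0) (cvc_cst c0)) => k /=.
  by rewrite /mu mulrCA colE // mulrA.
have mucv : cvc mu (c1 * (Th I1 J0 * c0)).
  apply: cvc_eq (cvcM (cvc_cst c1) (cvcol I1)) => k.
  by rewrite mulrA grI1 mul1r.
set m := c1 * _ in mucv.
have plcv I : cvc (fun k => plucker (gr (a_mx (s (phi k)))) I) (plucker (gr a) I).
  apply: cvc_det => i j; rewrite mxE.
  apply: (@cvc_eq _ (fun k => gr (a_mx (s (phi k))) (pel I i) j)).
    by move=> k; rewrite mxE.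
  case: (split_ordP (pel I i)) => l ->; rewrite /gr.
    rewrite col_mxEu; apply: cvc_eq (cvc_subseq inc (acv l j)) => k /=.
    by rewrite col_mxEu.
  by rewrite col_mxEd; apply: cvc_eq (cvc_cst _) => k; rewrite col_mxEd.
have ThE I : Th I J0 * c0 = plucker (gr a) I * m.
  exact: cvc_unique (cvcol I) (cvcM (plcv I) mucv).
(* Some entry of each normalized compound has modulus 1 and is at most K |mu k| by [compound_le]; so
   |mu k| >= 1/K for all k. *)
have m0 : m != 0.
  have [K K0 KP] := compound_le Ggrp r0 disj.
  apply/negP => /eqP m0; have iK0 : 0 < K^-1 by rewrite invr_gt0.
  have [k0 /(_ k0 (leqnn _))] := mucv _ iK0; rewrite m0 subr0.
  have [_ [_ [I [J eq1]]]] := kapP k0.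
  rewrite ltNge -[K^-1]mulr1 -[X in K^-1 * X]eq1 ler_pdivrMl // /mu !cabsM => /negP; apply.
  rewrite mulrCA ler_wpM2l ?cabs_ge0 //.
  exact: (KP _ (Gs _) (ns _)).
exists (fun J => (J == J0)%:R * (c0 / m)) => I.
rewrite (bigD1 J0) //= big1 ?addr0 => [|J /negbTE ->]; last by rewrite mul0r mulr0.
by rewrite eqxx mul1r mulrA ThE mulfK.
Qed.

End LimitPlanes.

(** Dependent choice, with [L k] the list of terms already chosen. The proviso on S is what lets
    [local_finiteness] offer such a list as a list of group elements. *)
Lemma avoiding_sequence (T : eqType) (P : nat -> T -> Prop) (E : T -> T -> Prop) :
  (forall k (S : seq T), (forall x, x \in S -> exists l, P l x) ->
    exists x, P k x /\ forall y, y \in S -> ~ E x y) ->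
  exists u : nat -> T, (forall k, P k (u k)) /\
    forall k l, (l < k)%N -> ~ E (u k) (u l).
Proof.
move=> H; have /choice[f fP] : forall kS : nat * seq T, exists x,
    (forall x, x \in kS.2 -> exists l, P l x) ->
    P kS.1 x /\ forall y, y \in kS.2 -> ~ E x y.
  move=> [k S]; have [/(H k S)[x xP]|nS] := pselect (forall x, x \in S -> exists l, P l x).
    by exists x.
  have [x _] : exists x, P k x /\ forall y, y \in [::] -> ~ E x y by apply: H.
  by exists x.
pose L := fix L k := if k is k'.+1 then f (k', L k') :: L k' else [::].
have LP k : forall x, x \in L k -> exists l, P l x.
  elim: k => [//|k IH] x; rewrite in_cons => /orP[/eqP ->|/IH //].
  by exists k; have [] := fP (k, L k) IH.
have uL k l : (l < k)%N -> f (l, L l) \in L k.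
  elim: k => // k IH; rewrite ltnS leq_eqVlt => /orP[/eqP ->|/IH h].
    by rewrite mem_head.
  by rewrite in_cons h orbT.
exists (fun k => f (k, L k)); split=> [k|k l lt_lk].
  by have [] := fP (k, L k) (LP k).
by have [_] := fP (k, L k) (LP k); apply; exact: uL.
Qed.

(** * Only finitely many g keep (g y)'' bounded for y near a point of Omega *)

Section LocalFiniteness.
Variables (R : realType) (n : nat).
Local Notation C := R[i].
Local Notation N := (n.+1 + n.+1)%N.
Local Notation mat := 'M[C]_N.
Variables (G : set mat) (r : R).
Hypothesis Ggrp : pgl_subgroup G.
Hypothesis r0 : 0 < r.
Hypothesis disj : forall g, G g -> ~ is_scalar g ->
  pt_image g (V_R r) `&` V_R r = set0.
Hypothesis Gclub : club G.
Hypothesis Gspade : spade G.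
Implicit Types (g h : mat).

Let Gunit g : G g -> g \in unitmx.
Proof. by case: Ggrp => + _ _ _ _; apply. Qed.
Let Gmul g h : G g -> G h -> G (g *m h).
Proof. by case: Ggrp => _ _ + _ _; apply. Qed.
Let Ginv g : G g -> G (invmx g).
Proof. by case: Ggrp => _ _ _ + _; apply. Qed.

(** C_{gh} = (C_g a_h + D_g) C_h and |a_h| <= r, so lower bounds on |C_h^-1| survive left
    multiplication by a fixed g. *)
Lemma opnorm_inv_Cblk_mul g : G g -> exists2 c : R, 0 < c & forall h,
  G h -> ~ is_scalar h -> ~ is_scalar (g *m h) ->
  opnorm (invmx (Cblk h)) <= opnorm (invmx (Cblk (g *m h))) * c.
Proof.
move=> Gg; pose c := opnorm (Cblk g) * r + opnorm (Dblk g) + 1; exists c.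
  by rewrite ltr_wpDl // addr_ge0 ?opnorm_ge0 // mulr_ge0 ?opnorm_ge0 // ltW.
move=> h Gh nsh nsgh; have uCh := Cblk_unit Ggrp disj Gh nsh.
have uCgh := Cblk_unit Ggrp disj (Gmul Gg Gh) nsgh.
pose M := Cblk g *m a_mx h + Dblk g.
have CE : Cblk (g *m h) = M *m Cblk h.
  by rewrite Cblk_mul mulmxDl /a_mx -!mulmxA mulVmx // mulmx1.
have -> : invmx (Cblk h) = invmx (Cblk (g *m h)) *m M.
  apply: (can_inj (mulmxK uCh)); rewrite mulVmx // -mulmxA -CE mulVmx //.
apply: le_trans (opnormM_le _ _) _; rewrite ler_wpM2l ?opnorm_ge0 //.
apply: opnorm_leP => v; rewrite mulmxDl -mulmxA.
apply: le_trans (vnormD _ _) _; rewrite mulrDl mul1r.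
apply: (@le_trans _ _ ((opnorm (Cblk g) * r + opnorm (Dblk g)) * vnorm v)); last first.
  by rewrite lerDl vnorm_ge0.
rewrite mulrDl; apply: lerD; last exact: opnorm_mulmx.
apply: le_trans (opnorm_mulmx _ _) _; rewrite -mulrA ler_wpM2l ?opnorm_ge0 //.
exact: (a_mx_le Ggrp disj).
Qed.

(* Condition (spade) only concerns the set of norms, so a priori |C_k^-1| could
   repeat one value infinitely often.  Then for each g some subsequence of
   |C_{g s_k}^-1| is constant, hence the Gram matrices of C_{g s_k} and C_{g s_l}
   share an eigenvalue.  This is a polynomial condition in g, of bounded degree, so
   finitely many g suffice to get k <> l for which it holds for all g; but it fails
   at g = s_k^-1, where the first Gram matrix is 0 and the second is invertible. *)
Lemma opnorm_inv_Cblk_not_bounded_below (s : nat -> mat) (e : R) : 0 < e ->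
  (forall k, nontriv_SL G (s k)) -> (forall k l, k <> l -> ~ proj_eq (s k) (s l)) ->
  ~ (forall k, e <= opnorm (invmx (Cblk (s k)))).
Proof.
move=> e0 sP dist ge_e; have [M MP] := Gclub.
pose D g := G g /\ \det g = 1.
have [L LD LP] := frank_finitely_generated D (@frank_sylv_gram R n).
have [phi inc phiP] : exists2 phi, increasing phi & forall g, g \in L -> exists x,
    forall k, nontriv_SL G (g *m s (phi k)) /\
      opnorm (invmx (Cblk (g *m s (phi k)))) = x.
  elim: L LD {LP} => [_|g L IH LD]; first by exists id.
  have [|phi inc phiP] := IH; first by move=> h hL; apply: LD; rewrite in_cons hL orbT.
  have [Gg dg] := LD g (mem_head _ _).
  (* The s_k are distinct in PGL, so [g *m s (phi k)] is scalar for at most one k, and a tail is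
     free of scalars. *)
  have ss k l : is_scalar (g *m s (phi k)) -> is_scalar (g *m s (phi l)) -> k = l.
    move=> [a ea] [b eb]; apply: contrapT => ne.
    have [[Gk _ _] [Gl _ _]] := (sP (phi k), sP (phi l)).
    have ne' : phi l <> phi k by move/(increasing_inj inc)/esym.
    apply: (dist _ _ ne'); apply: (proj_eq_of_scalar (Gunit Gk) (Gunit Gl)).
    have sE l' c : g *m s (phi l') = c%:M -> s (phi l') = c *: invmx g.
      by move=> ec; rewrite -[LHS](mulKmx (Gunit Gg)) ec mul_mx_scalar.
    have a0 : a != 0.
      apply: contraTneq (Gunit Gk) => a0.
      by rewrite (sE _ _ ea) a0 scale0r unitmxE det0 unitr0.
    have sl : s (phi l) = (b / a) *: s (phi k).
      by rewrite (sE _ _ ea) (sE _ _ eb) scalerA divfK.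
    by exists (b / a); rewrite sl -scalemxAr mulVmx ?Gunit // scalemx1.
  have [k0 k0P] : exists k0, forall k, (k0 <= k)%N -> ~ is_scalar (g *m s (phi k)).
    have [[k1 sc]|no] := pselect (exists k, is_scalar (g *m s (phi k))); last first.
      by exists 0%N => k _ sc; apply: no; exists k.
    by exists k1.+1 => k lt_k /(ss _ _ sc) e1; move: lt_k; rewrite e1 ltnn.
  have [c c0 cP] := opnorm_inv_Cblk_mul Gg.
  have gsP k : nontriv_SL G (g *m s (phi (k0 + k)%N)).
    have [Gk dk _] := sP (phi (k0 + k)%N).
    by split; [exact: Gmul|rewrite det_mulmx dg dk mul1r|apply: k0P; rewrite leq_addr].
  pose u k := opnorm (invmx (Cblk (g *m s (phi (k0 + k)%N)))).
  have uR k : Rset G (u k) by exists (g *m s (phi (k0 + k)%N)).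
  (* The upper bound is (club); the lower one keeps cluster points off 0, where (spade) says
     nothing. *)
  have uM k : e / c <= u k <= M.
    rewrite MP // andbT ler_pdivrMr //; apply: le_trans (ge_e _) _.
    apply: cP; first by have [] := sP (phi (k0 + k)%N).
      by have [] := sP (phi (k0 + k)%N).
    by have [] := gsP k.
  have [x xP] := repeated_value Gspade (divr_gt0 e0 c0) uR uM.
  have [//|psi inc' psiP] := @increasing_subseq (fun _ l => u l = x).
  exists (fun k => phi (k0 + psi k)%N).
    by move=> k l /inc' lt_kl; apply: inc; rewrite ltn_add2l.
  move=> h; rewrite in_cons => /orP[/eqP ->|/phiP[y yP]].
    by exists x => k; split; [exact: gsP|exact: psiP].
  by exists y => k; exact: yP.
pose x := s (phi 0%N); pose y := s (phi 1%N).
have [Gx dx nsx] : nontriv_SL G x by exact: sP.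
have [Gy dy nsy] : nontriv_SL G y by exact: sP.
have vanish g : g \in L -> \det (sylv (gram (g *m x)) (gram (g *m y))) = 0.
  move=> /phiP[t tP]; have [[Ggx _ nsgx] ex] := tP 0%N; have [[Ggy _ nsgy] ey] := tP 1%N.
  have [u1 u10] := opnorm_invmx_eigen (Cblk_unit Ggrp disj Ggx nsgx).
  have [u2 u20] := opnorm_invmx_eigen (Cblk_unit Ggrp disj Ggy nsgy).
  rewrite ex ey => eig2 eig1.
  exact: (sylv_common (adj_gram _) u10 u20 eig1 eig2).
have Dx : D (invmx x) by split; [exact: Ginv|rewrite det_inv dx invr1].
have := LP (x, y) vanish _ Dx; rewrite /= mulVmx ?Gunit //.
rewrite {1}/gram Cblk1 mulmx0; apply/eqP/sylv0_det.
have nsxy : ~ is_scalar (invmx x *m y).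
  move=> /(proj_eq_of_scalar (Gunit Gx) (Gunit Gy)); apply: dist.
  by move/(increasing_inj inc).
have uC := Cblk_unit Ggrp disj (Gmul (Ginv Gx) Gy) nsxy.
by rewrite /gram unitmx_mul adj_unit uC.
Qed.

Lemma local_finiteness z (L : R) : Omega G z -> 0 < L ->
  exists2 e : R, 0 < e & exists2 S : seq mat, {in S, forall s, nontriv_SL G s} &
    forall y g, vnorm (y - z) < e -> nontriv_SL G g -> vnorm (zpp (g *m y)) <= L ->
      exists2 s, s \in S & proj_eq g s.
Proof.
move=> Oz L0; apply: contrapT => H.
pose P k (x : mat * 'cV[C]_N) := [/\ nontriv_SL G x.1,
  vnorm (x.2 - z) < k.+1%:R^-1 & vnorm (zpp (x.1 *m x.2)) <= L].
have [k S SP|u [uP udist]] := @avoiding_sequence _ P (fun x y => proj_eq x.1 y.1).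
  apply: contrapT => no; apply: H; exists k.+1%:R^-1; first by rewrite invr_gt0.
  exists (map fst S); first by move=> _ /mapP[x /SP[l [lP _ _]] ->].
  move=> y g lt_y gP le_L; apply: contrapT => no2; apply: no; exists (g, y).
  split=> // s sS pe; apply: no2; exists s.1 => //; exact: map_f.
pose g k := (u k).1; pose y k := (u k).2.
have gP k : nontriv_SL G (g k) by have [] := uP k.
have gdist k l : k <> l -> ~ proj_eq (g k) (g l).
  by move=> /eqP; rewrite neq_ltn => /orP[] /udist h // /proj_eq_sym.
pose s k := invmx (g k).
have Gs k : G (s k) by have [Gg _ _] := gP k; exact: Ginv.
have nss k : ~ is_scalar (s k).
  by have [Gg _ ns] := gP k => /(is_scalarV (Gunit Gg)).
have sdist k l : k <> l -> ~ proj_eq (s k) (s l).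
  move=> /gdist ne [a [a0 e1]]; apply: ne; apply: proj_eq_sym; exists a; split=> //.
  have [[Gk _ _] [Gl _ _]] := (gP k, gP l).
  have : g k *m (s k *m g l) = g k *m ((a *: s l) *m g l) by rewrite -e1.
  by rewrite mulKVmx ?Gunit // -scalemxAl mulVmx ?Gunit // scalemx1 mul_mx_scalar.
have [k x|phi inc [l lP]] := @cvc_extract_fin _ _
    (fun k (x : 'I_n.+1 * 'I_n.+1) => a_mx (s k) x.1 x.2) r.
  by apply: entry_le_of_vnorm => v; exact: (a_mx_le Ggrp disj).
pose a : 'M[C]_n.+1 := \matrix_(i, j) l (i, j).
have acv i j : cvc (fun k => a_mx (s (phi k)) i j) (a i j).
  by rewrite mxE; exact: (lP (i, j)).
have lim : limit_nplane G (col_mx a 1%:M).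
  apply: (limit_nplane_graph Ggrp r0 disj (fun k => Gs (phi k))
    (fun k => nss (phi k)) _ acv) => k k' ne.
  by apply: sdist => /(increasing_inj inc).
(* w = 0 would place z on the graph of a, a limit n-plane. *)
pose w := zp z - a *m zpp z.
have w0 : w != 0.
  apply/negP; rewrite subr_eq0 => /eqP zpE; have [z0] := Oz; apply.
  exists (col_mx a 1%:M); split=> //; split=> //; exists (zpp z).
  by rewrite mul_col_mx mul1mx -zpE vsubmxK.
have [i wi0] : exists i, w i 0 != 0.
  apply: contrapT => no; case/negP: w0; apply/eqP/colP => i; rewrite [RHS]mxE.
  by apply/eqP/negPn/negP => wi; apply: no; exists i.
have ycv j : cvc (fun k => y (phi k) j 0) (z j 0).
  move=> e e0; exists (Num.truncn e^-1) => k lek.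
  have [_ yk _] := uP (phi k); apply: (@le_lt_trans _ _ (vnorm (y (phi k) - z))).
    by have := coord_le_vnorm (y (phi k) - z) j; rewrite !mxE.
  apply: lt_trans yk _; rewrite -[ltRHS]invrK ltf_pV2 ?posrE ?invr_gt0 //.
  apply: lt_le_trans (truncnS_gt _) _.
  by rewrite ler_nat ltnS (leq_trans lek) // increasing_ge.
pose xk k := zp (y (phi k)) - a_mx (s (phi k)) *m zpp (y (phi k)).
have xcv : cvc (fun k => xk k i 0) (w i 0).
  have sumcv : cvc (fun k => \sum_j a_mx (s (phi k)) i j * zpp (y (phi k)) j 0)
      (\sum_j a i j * zpp z j 0).
    apply: (@cvc_sum _ _ _ xpredT
      (fun k j => a_mx (s (phi k)) i j * zpp (y (phi k)) j 0)
      (fun j => a i j * zpp z j 0)) => j.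
    apply: cvcM; first exact: acv.
    by rewrite mxE; apply: cvc_eq (ycv (rshift n.+1 j)) => k; rewrite mxE.
  have := cvcD (ycv (lshift n.+1 i)) (cvcM (cvc_cst (-1)) sumcv).
  have -> : w i 0 = z (lshift n.+1 i) 0 + -1 * (\sum_j a i j * zpp z j 0).
    by rewrite mulN1r /w !mxE.
  by apply: cvc_eq => k; rewrite mulN1r /xk !mxE.
have d0 : 0 < cabs (w i 0) / 2 by rewrite divr_gt0 // cabs_gt0.
have [k0 k0P] := xcv _ d0.
(* From |w_i|/2 <= |x_k| <= |C^-1| |C x_k| <= |C^-1| L, since C x_k is the z''-part of g_k y_k. *)
have dL : 0 < cabs (w i 0) / 2 / L by rewrite divr_gt0.
apply: (@opnorm_inv_Cblk_not_bounded_below (fun k => g (phi (k0 + k)%N)) _ dL).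
- by move=> k; exact: gP.
- by move=> k k' ne; apply: gdist => /(increasing_inj inc)/addnI.
move=> k; set kk := (k0 + k)%N; have [Gg dg ns] := gP (phi kk).
rewrite ler_pdivrMr //.
have le_x : cabs (w i 0) / 2 <= vnorm (xk kk).
  apply: le_trans (coord_le_vnorm _ i).
  exact: cabs_ge_half (k0P kk (leq_addr _ _)).
apply: le_trans le_x _.
have uC := Cblk_unit Ggrp disj Gg ns.
apply: le_trans (opnorm_invmx_lower (xk kk) uC) _.
rewrite ler_wpM2l ?opnorm_ge0 //; have [_ _] := uP (phi kk); apply: le_trans.
by rewrite (zpp_mul_a Ggrp disj _ Gg ns).
Qed.

End LocalFiniteness.

(** * The F-region and minimality of |z''| on orbits *)

Section FRegion.
Variables (R : realType) (n : nat).
Local Notation C := R[i].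
Local Notation N := (n.+1 + n.+1)%N.
Local Notation mat := 'M[C]_N.
Local Notation vec := 'cV[C]_N.
Variables (G : set mat) (r : R).
Hypothesis Ggrp : pgl_subgroup G.
Hypothesis r0 : 0 < r.
Hypothesis disj : forall g, G g -> ~ is_scalar g ->
  pt_image g (V_R r) `&` V_R r = set0.
Implicit Types (g h : mat) (z y w : vec).

Local Notation f g z := (vnorm (zpp (g *m z))).

Let Gunit g : G g -> g \in unitmx.
Proof. by case: Ggrp => + _ _ _ _; apply. Qed.
Let Gmul g h : G g -> G h -> G (g *m h).
Proof. by case: Ggrp => _ _ + _ _; apply. Qed.
Let Ginv g : G g -> G (invmx g).
Proof. by case: Ggrp => _ _ _ + _; apply. Qed.
Lemma mulmx_unit_neq0 g z : g \in unitmx -> z != 0 -> g *m z != 0.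
Proof.
by move=> ug; apply: contraNneq => /(congr1 (mulmx (invmx g))); rewrite mulKmx // mulmx0 => ->.
Qed.

Lemma zppZ (c : C) z : zpp (c *: z) = c *: zpp z.
Proof. by rewrite /zpp linearZ. Qed.

Lemma zppD y z : zpp (y + z) = zpp y + zpp z.
Proof. by rewrite /zpp linearD. Qed.

Lemma zppB y z : zpp (y - z) = zpp y - zpp z.
Proof. by rewrite /zpp linearB. Qed.

Lemma zpp_sub_le y z : vnorm (zpp y) - vnorm (zpp z) <= vnorm (y - z).
Proof.
by apply: le_trans (vnorm_subr_le _ _) _; rewrite -zppB; exact: dsubmx_le_vnorm.
Qed.

Lemma zp_sub_le y z : vnorm (zp y) - vnorm (zp z) <= vnorm (y - z).
Proof.
apply: le_trans (vnorm_subr_le _ _) _; rewrite /zp -linearB.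
exact: usubmx_le_vnorm.
Qed.

Lemma zpp_lipschitz g : exists2 k : R, 0 < k & forall y z,
  vnorm (g *m y - g *m z) <= k * vnorm (y - z) /\ f g y <= f g z + k * vnorm (y - z).
Proof.
exists (entry_sum g + 1); first by rewrite ltr_wpDl ?entry_sum_ge0.
move=> y z; have le_k : vnorm (g *m y - g *m z) <= (entry_sum g + 1) * vnorm (y - z).
  rewrite -mulmxBr; apply: le_trans (vnorm_mulmx_le _ _) _.
  by rewrite ler_wpM2r ?vnorm_ge0 // lerDl.
split=> //; rewrite -lerBlDl; exact: le_trans (zpp_sub_le _ _) _.
Qed.

(** Representatives of determinant 1 differ by a root of unity, which does not affect |(g z)''|. *)
Lemma cabs1_of_det (c : C) g h : g = c *: h -> \det g = 1 -> \det h = 1 -> cabs c = 1.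
Proof.
move=> -> + dh; rewrite detZ dh mulr1 => /(congr1 (@cabs R)).
rewrite cabsX cabs1 => /eqP; rewrite pexpr_eq1 ?addn_gt0 ?cabs_ge0 //.
by move/eqP.
Qed.

Lemma nontriv_SL_inv g : nontriv_SL G g -> nontriv_SL G (invmx g).
Proof.
move=> [Gg dg ns]; split; [exact: Ginv|by rewrite det_inv dg invr1|].
by move=> /(is_scalarV (Gunit Gg)).
Qed.

Lemma SL_lift g : G g -> ~ is_scalar g -> exists2 c : C, c != 0 & nontriv_SL G (c *: g).
Proof.
move=> Gg ns; have dg : \det g != 0 by rewrite -unitfE -unitmxE Gunit.
pose c : C := N.-root (\det g)^-1.
have cN : c ^+ N = (\det g)^-1 by rewrite rootCK.
have c0 : c != 0.
  by apply: contraNneq dg => c0; move: cN; rewrite c0 expr0n /= => /esym/eqP; rewrite invr_eq0.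
exists c => //; split.
- by case: Ggrp => _ _ _ _; apply.
- by rewrite detZ cN mulVf.
- move=> [a ea]; apply: ns; exists (c^-1 * a).
  by rewrite -scale_scalar_mx -ea scalerA mulVf // scale1r.
Qed.

Lemma Delta_gP g z : Delta_g g z <-> z != 0 /\ vnorm (zpp z) <= f g z.
Proof. by rewrite [in f g z]/zpp dsubmx_mul. Qed.

Lemma Delta_scale (c : C) z : c != 0 -> Delta G z -> Delta G (c *: z).
Proof.
move=> c0 [z0 D]; have cz0 : c *: z != 0 by rewrite scaler_eq0 negb_or c0.
split=> [|g /D/Delta_gP[_ le_z]]; first exact: cz0.
apply/Delta_gP; split; first exact: cz0.
by rewrite -(scalemxAr c g z) 2!zppZ 2!vnormZ ler_wpM2l ?cabs_ge0.
Qed.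

Lemma Delta_le g z : Delta G z -> nontriv_SL G g -> vnorm (zpp z) <= f g z.
Proof. by move=> [_ D] /D/Delta_gP[]. Qed.

Lemma Freg_Delta z : Freg G z -> Delta G z.
Proof.
by move=> [z0 [e e0 h]]; apply: h; rewrite subrr vnorm0.
Qed.

Lemma Freg_scale (c : C) z : c != 0 -> Freg G z -> Freg G (c *: z).
Proof.
move=> c0 [z0 [e e0 h]]; split; first by rewrite scaler_eq0 negb_or c0.
have ac0 : 0 < cabs c by rewrite cabs_gt0.
exists (cabs c * e); first exact: mulr_gt0.
move=> y lt_y; rewrite -(scale1r y) -(mulfV c0) -scalerA.
apply: Delta_scale => //; apply: h.
have -> : c^-1 *: y - z = c^-1 *: (y - c *: z).
  by rewrite scalerBr scalerA mulVf // scale1r.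
by rewrite vnormZ cabsV ltr_pdivrMl.
Qed.

(* Along a direction x with (g x)'' = 0 and x'' <> 0 the form |(g y)''|^2 - |y''|^2
   is strictly concave, so it cannot vanish at an interior minimum. *)
Lemma Freg_lt g z : Freg G z -> nontriv_SL G g -> vnorm (zpp z) < f g z.
Proof.
move=> [z0 [e e0 h]] gP; have [Gg dg ns] := gP.
pose v : 'cV[C]_n.+1 := delta_mx ord0 0.
pose x := col_mx (- (b_mx g *m v)) v.
have gx : zpp (g *m x) = 0.
  by rewrite /zpp (dsubmx_mul_b Ggrp disj) // /x col_mxKu col_mxKd addNr mulmx0.
have zx : zpp x = v by rewrite /zpp /x col_mxKd.
pose t : R := e / (vnorm x + 1); have x1 : 0 < vnorm x + 1 by rewrite ltr_wpDl ?vnorm_ge0.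
have t0 : 0 < t by rewrite divr_gt0.
pose tc : C := t%:C%C.
have ctc : cabs tc = t by rewrite cabsR gtr0_norm.
have tx : vnorm (tc *: x) < e.
  by rewrite vnormZ ctc /t mulrAC ltr_pdivrMr // ltr_pM2l // ltrDl.
have hp : vnorm (zpp (z + tc *: x)) <= f g (z + tc *: x).
  by apply: Delta_le => //; apply: h; rewrite addrC addKr.
have hm : vnorm (zpp (z - tc *: x)) <= f g (z - tc *: x).
  by apply: Delta_le => //; apply: h; rewrite addrC addKr vnormN.
have gp : zpp (g *m (z + tc *: x)) = zpp (g *m z).
  by rewrite mulmxDr -scalemxAr zppD zppZ gx scaler0 addr0.
have gm : zpp (g *m (z - tc *: x)) = zpp (g *m z).
  by rewrite mulmxBr -scalemxAr zppB zppZ gx scaler0 subr0.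
have zpE : zpp (z + tc *: x) = zpp z + tc *: v by rewrite zppD zppZ zx.
have zmE : zpp (z - tc *: x) = zpp z - tc *: v by rewrite zppB zppZ zx.
rewrite gp zpE in hp; rewrite gm zmE in hm.
(* With p, m <= u the identity p^2 + m^2 = 2 (q^2 + t^2) gives u^2 >= q^2 + t^2 > q^2. *)
have := vnorm_parallelogram (zpp z) (tc *: v).
rewrite vnormZ ctc vnorm_delta mulr1.
move: hp hm (vnorm_ge0 (zpp z + tc *: v)) (vnorm_ge0 (zpp z - tc *: v)).
move: (vnorm_ge0 (zpp z)) (vnorm_ge0 (zpp (g *m z))).
move: (vnorm (zpp z + _)) (vnorm (zpp z - _)) (vnorm (zpp z)) (f g z).
move=> p m q u q0 u0 pu mu p0 m0 par.
rewrite -(@ltr_pXn2r _ 2%N) ?nnegrE //.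
have p2 : p ^+ 2 <= u ^+ 2 by rewrite ler_pXn2r ?nnegrE.
have m2 : m ^+ 2 <= u ^+ 2 by rewrite ler_pXn2r ?nnegrE.
have t2 : 0 < t ^+ 2 by rewrite exprn_gt0.
move: par p2 m2 t2; move: (p ^+ 2) (m ^+ 2) (q ^+ 2) (u ^+ 2) (t ^+ 2) => a b c d k; lra.
Qed.

Lemma Fbar_Delta z : Fbar G z -> Delta G z.
Proof.
move=> [z0 cl]; split=> // g gP; apply/Delta_gP; split=> //.
rewrite leNgt; apply/negP => lt_z.
have [k k0 kP] := zpp_lipschitz g.
(* The Lipschitz constants are 1 for |z''| and k for |(g z)''|. *)
pose e := (vnorm (zpp z) - f g z) / (k + 1).
have k1 : 0 < k + 1 by rewrite addr_gt0.
have e0 : 0 < e by rewrite divr_gt0 // subr_gt0.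
have [y [Fy lt_y]] := cl e e0.
have le_y := Delta_le (Freg_Delta Fy) gP.
have [_ gy] := kP y z.
have zy : vnorm (zpp z) - vnorm (zpp y) <= vnorm (y - z).
  by rewrite (vnormB y); exact: zpp_sub_le.
have ee : e * (k + 1) = vnorm (zpp z) - f g z by rewrite /e divfK // gt_eqF.
have d0 : vnorm (y - z) * (k + 1) < e * (k + 1) by rewrite ltr_pM2r.
move: zy gy le_y d0; rewrite ee.
move: (f g y) (f g z) (vnorm (zpp y)) (vnorm (zpp z)) (vnorm (y - z)) => a b c d p.
rewrite mulrDr mulr1 [k * _]mulrC; lra.
Qed.

Lemma Freg_nonempty : club G -> exists z, Freg G z.
Proof.
move=> [M0 M0P].
have [M M_gt0 MP] : exists2 M, 0 < M &
    forall g, nontriv_SL G g -> opnorm (invmx (Cblk g)) <= M.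
  exists (`|M0| + 1) => [|g gP]; first by rewrite ltr_wpDl.
  apply: (@le_trans _ _ M0); first by apply: M0P; exists g.
  by apply: le_trans (ler_norm _) _; rewrite lerDl.
pose x : 'cV[C]_n.+1 := delta_mx ord0 0; pose z : vec := col_mx x 0.
have x0 : x != 0 by rewrite -vnorm_gt0 vnorm_delta.
have z0 : z != 0 by rewrite col_mx_eq0 (negbTE x0).
(* e solves 1 - e = (M + r) e. Then |z'| >= (M + r)|z''|, so |z' + b_g z''| >= M |z''|, while it is
   at most M |(g y)''|. *)
exists z; split=> //; pose e := (1 + M + r)^-1.
have d0 : 0 < 1 + M + r by rewrite !addr_gt0.
have e0 : 0 < e by rewrite invr_gt0.
exists e => // y lt_y.
have y'' : vnorm (zpp y) < e.
  apply: le_lt_trans lt_y; have -> : zpp y = zpp (y - z).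
    by rewrite zppB /z /zpp col_mxKd subr0.
  exact: dsubmx_le_vnorm.
have y' : 1 - e < vnorm (zp y).
  rewrite ltrBlDr -ltrBlDl; apply: le_lt_trans lt_y.
  have -> : 1 = vnorm (zp z) by rewrite /zp /z col_mxKu vnorm_delta.
  by rewrite (vnormB y); exact: zp_sub_le.
have Mr : (M + r) * vnorm (zpp y) <= vnorm (zp y).
  apply/ltW; apply: le_lt_trans y'.
  have -> : 1 - e = (M + r) * e by rewrite /e; field; rewrite gt_eqF.
  by rewrite ler_wpM2l ?(ltW y'') // ltW // addr_gt0.
have y0 : y != 0.
  apply: contraTneq y' => ->; rewrite /zp linear0 vnorm0 -leNgt subr_ge0.
  by rewrite /e invf_le1 // -addrA lerDl ltW // addr_gt0.
split=> // g gP; apply/Delta_gP; split=> //.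
have [Gg _ ns] := gP; have uC := Cblk_unit Ggrp disj Gg ns.
rewrite [in f g y]/zpp (dsubmx_mul_b Ggrp disj) //.
set w := _ + _; have le_w : M * vnorm (zpp y) <= vnorm w.
  have := vnorm_subr_le (zp y) (- (b_mx g *m zpp y)); rewrite opprK vnormN -/w => h1.
  have h2 := b_mx_le Ggrp r0 disj (zpp y) Gg ns.
  move: Mr h1 h2; rewrite mulrDl.
  move: (vnorm _) (vnorm _) (vnorm _) (vnorm _) => a b c d; lra.
have := opnorm_invmx_lower w uC; set u := vnorm (_ *m w) => h3.
rewrite -(ler_pM2l M_gt0); apply: le_trans le_w _; apply: le_trans h3 _.
by rewrite ler_wpM2r ?vnorm_ge0 ?MP.
Qed.

(** Strict minimality at z contradicts weak minimality at g z, compared through g^-1. Asking only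
    for [Delta] at g z covers points of the closure as well. *)
Lemma translate_disjoint g z : G g -> ~ is_scalar g ->
  Freg G z -> Delta G (g *m z) -> False.
Proof.
move=> Gg ns Fz Dgz; have [c c0 cP] := SL_lift Gg ns.
have lt1 := Freg_lt Fz cP; have := Delta_le (Delta_scale c0 Dgz) (nontriv_SL_inv cP).
rewrite scalemxAl mulKmx ?leNgt ?lt1 //.
by have [Gcg _ _] := cP; exact: Gunit.
Qed.

(* Finitely many closed sets {f s <= f t for all t} cover each ball, so one of them
   has interior points there. *)
Lemma minimal_on_ball (S : seq mat) s0 z (e : R) : 0 < e ->
  exists y d s, [/\ s \in s0 :: S, 0 < d,
    forall y', vnorm (y' - y) < d -> vnorm (y' - z) < e &
    forall y', vnorm (y' - y) < d -> {in s0 :: S, forall t, f s y' <= f t y'}].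
Proof.
move=> e0; elim: S => [|t S [y [d [s [sS d0 sub min]]]]].
  by exists z, e, s0; split=> // [|y' _ t]; rewrite ?mem_head // inE => /eqP ->.
have in_tS u : u \in s0 :: S -> u \in [:: s0, t & S].
  by rewrite !in_cons => /orP[->//|->]; rewrite !orbT.
have tS : t \in [:: s0, t & S] by rewrite !in_cons eqxx orbT.
have tScase u : u \in [:: s0, t & S] -> u = t \/ u \in s0 :: S.
  by rewrite !in_cons => /or3P[->|/eqP ->|->]; rewrite ?orbT; auto.
have [[y1 [lt_y1 lt_f]]|no] :=
    pselect (exists y1, vnorm (y1 - y) < d /\ f t y1 < f s y1); last first.
  exists y, d, s; split=> // [|y' lt_y' u /tScase[->|uS]]; first exact: in_tS.
    by rewrite leNgt; apply/negP => lt_f; apply: no; exists y'.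
  exact: min.
have [k k0 kP] := zpp_lipschitz t; have [l l0 lP] := zpp_lipschitz s.
(* The gap at y1 between s and t closes at rate at most k + l, so t stays below s, which was already
   minimal on the larger ball. *)
pose d1 := Num.min (d - vnorm (y1 - y)) ((f s y1 - f t y1) / (k + l)).
have kl : 0 < k + l by rewrite addr_gt0.
have d10 : 0 < d1 by rewrite lt_min subr_gt0 lt_y1 divr_gt0 // subr_gt0.
have in_d y' : vnorm (y' - y1) < d1 -> vnorm (y' - y) < d.
  rewrite lt_min => /andP[lt1 _]; rewrite -(subrK y1 y') -addrA.
  by apply: le_lt_trans (vnormD _ _) _; rewrite -ltrBrDr.
exists y1, d1, t; split=> // [y' /in_d/sub //|y' lt_y' u /tScase[->//|uS]].
apply: le_trans (min y' (in_d _ lt_y') u uS).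
move: lt_y'; rewrite lt_min ltr_pdivlMr // mulrDr => /andP[_ /ltW lt2].
have [_ h1] := kP y' y1; have [_ h2] := lP y1 y'; rewrite (vnormB y1) in h2.
move: lt2 h1 h2; rewrite [k * _]mulrC [l * _]mulrC.
move: (_ * k) (_ * l) (f s y1) (f t y1) (f s y') (f t y') => a b p q u' v'; lra.
Qed.

Lemma uniform_radius (T : eqType) (S : seq T) (P : T -> R -> Prop) :
  (forall s d d', P s d -> d' <= d -> P s d') ->
  (forall s, s \in S -> exists2 d, 0 < d & P s d) ->
  exists2 d, 0 < d & {in S, forall s, P s d}.
Proof.
move=> mono; elim: S => [|s S IH] H; first by exists 1.
have [|d d0 dP] := IH; first by move=> t tS; apply: H; rewrite in_cons tS orbT.
have [d' d'0 d'P] := H s (mem_head _ _).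
exists (Num.min d d'); first by rewrite lt_min d0.
move=> t; rewrite in_cons => /orP[/eqP ->|/dP tP].
  by apply: mono d'P _; rewrite ge_min lexx orbT.
by apply: mono tP _; rewrite ge_min lexx.
Qed.

Lemma orbit_meets_Fbar z : club G -> spade G -> Omega G z ->
  exists2 g, G g & Fbar G (g *m z).
Proof.
move=> Gclub Gspade Oz; have [z0 _] := Oz.
(* Within distance 1 of z one has |y''| < L, so elements outside the finite list, with |(g y)''| >
   L, are never minimal there. *)
pose L := vnorm (zpp z) + 1.
have L0 : 0 < L by rewrite ltr_wpDl ?vnorm_ge0.
have [e1 e10 [S SP lf]] := local_finiteness Ggrp r0 disj Gclub Gspade Oz L0.
have S1P s : s \in 1%:M :: S -> G s /\ \det s = 1.
  rewrite in_cons => /orP[/eqP ->|/SP[]//].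
  by split; [case: Ggrp|exact: det1].
pose e0 := Num.min e1 (Num.min 1 (vnorm z)).
have e00 : 0 < e0 by rewrite !lt_min e10 ltr01 vnorm_gt0.
have e0P y : vnorm (y - z) < e0 -> [/\ vnorm (y - z) < e1, vnorm (zpp y) < L & y != 0].
  rewrite !lt_min => /and3P[lt1 lt2 lt3]; split=> //; last first.
    by apply: contraTneq lt3 => ->; rewrite sub0r vnormN ltxx.
  rewrite /L addrC -ltrBlDr; exact: le_lt_trans (zpp_sub_le _ _) lt2.
(* Minimality of s within the finite list is minimality over the group: h s is scalar, or
   proportional to a listed element, or exceeds L. *)
have interior y d s : s \in 1%:M :: S -> 0 < d ->
    (forall y', vnorm (y' - y) < d -> vnorm (y' - z) < e0) ->
    (forall y', vnorm (y' - y) < d -> {in 1%:M :: S, forall t, f s y' <= f t y'}) ->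
    Freg G (s *m y).
  move=> sS d0 sub min; have [Gs ds] := S1P s sS.
  have Dy' y' : vnorm (y' - y) < d -> Delta G (s *m y').
    move=> lt_y'; have [lt1 ltL y'0] := e0P _ (sub _ lt_y').
    have sy0 := mulmx_unit_neq0 (Gunit Gs) y'0.
    split=> // h hP; apply/Delta_gP; split=> //; rewrite mulmxA.
    have [Gh dh _] := hP; have dhs : \det (h *m s) = 1 by rewrite det_mulmx dh ds mulr1.
    have le_t (c : C) t : t \in 1%:M :: S -> h *m s = c *: t ->
        f s y' <= f (h *m s) y'.
      move=> tS ehs; have [_ dt] := S1P t tS.
      rewrite ehs -scalemxAl zppZ vnormZ (cabs1_of_det ehs) // mul1r.
      exact: min.
    have [[c ec]|nsc] := pselect (is_scalar (h *m s)).
      by apply: (le_t c 1%:M); rewrite ?mem_head // scalemx1.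
    have [le_L|lt_L] := leP (f (h *m s) y') L.
      have [|t tS [c [_ ec]]] := lf y' (h *m s) lt1 _ le_L.
        by split=> //; exact: Gmul.
      by apply: (le_t c t) => //; rewrite in_cons tS orbT.
    apply/ltW; apply: le_lt_trans lt_L; apply/ltW; apply: le_lt_trans ltL.
    by have := min y' lt_y' 1%:M (mem_head _ _); rewrite mul1mx.
  split; first by have [] := Dy' y; rewrite ?subrr ?vnorm0.
  have [k k0 kP] := zpp_lipschitz (invmx s).
  exists (d / k); first exact: divr_gt0.
  move=> w lt_w; rewrite -(mulKVmx (Gunit Gs) w); apply: Dy'.
  have [le_k _] := kP w (s *m y); rewrite mulKmx ?Gunit // in le_k.
  by apply: le_lt_trans le_k _; rewrite mulrC -ltr_pdivlMr.
(* If no s z with s in the list lies in the closure of F, one radius around z works for all s, and a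
   ball inside it contradicts [interior]. *)
apply: contrapT => no.
have [|s sS|d d0 dP] := @uniform_radius _ (1%:M :: S)
    (fun s d => forall y, vnorm (y - z) < d -> ~ Freg G (s *m y)).
- by move=> s d d' H le_d y lt_y; apply: H; exact: lt_le_trans lt_y le_d.
- have [Gs _] := S1P s sS; apply: contrapT => H; apply: no; exists s => //.
  split=> [|e e_gt0]; first exact: mulmx_unit_neq0 (Gunit Gs) z0.
  have [k k0 kP] := zpp_lipschitz s.
  apply: contrapT => H1; apply: H; exists (e / k); first exact: divr_gt0.
  move=> y lt_y Fy; apply: H1; exists (s *m y); split=> //.
  have [le_k _] := kP y z; apply: le_lt_trans le_k _.
  by rewrite mulrC -ltr_pdivlMr.
have ed : 0 < Num.min e0 d by rewrite lt_min e00.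
have [y [d' [s [sS d'0 sub min]]]] := minimal_on_ball S 1%:M z ed.
have := sub y; rewrite subrr vnorm0 => /(_ d'0); rewrite lt_min => /andP[_].
move/(dP s sS); apply; apply: (interior y d') => // y' /sub.
by rewrite lt_min => /andP[].
Qed.

End FRegion.

Theorem theorem7p11 (R : realType) (n : nat)
    (G : set 'M[R[i]]_(n.+1 + n.+1)) (r : R) :
  type_L G ->
  0 < r ->
  V_R r `<=` Omega G ->
  (forall g, G g -> ~ is_scalar g -> pt_image g (V_R r) `&` V_R r = set0) ->
  torsion_free G -> club G -> spade G ->
  [/\ (forall g, G g -> (pt_image g (Freg G) `<=` Freg G <-> is_scalar g)),
      (forall g, G g -> ~ is_scalar g -> pt_image g (Freg G) `&` Freg G = set0),
      (forall z, Omega G z -> exists2 g, G g & (Omega G `&` Fbar G) (g *m z)) &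
      (forall z w g, (Omega G `&` Fbar G) z -> (Omega G `&` Fbar G) w ->
         G g -> ~ is_scalar g -> w = g *m z ->
         (Omega G `&` bdFbar G) z /\ (Omega G `&` bdFbar G) w)].
Proof.
move=> [Ggrp _] r0 _ disj _ Gclub Gspade.
have Gunit g : G g -> g \in unitmx by case: Ggrp => + _ _ _ _; apply.
split.
- move=> g Gg; split=> [sub|[a ea] _ [z Fz <-]].
    apply: contrapT => ns; have [z Fz] := Freg_nonempty Ggrp r0 disj Gclub.
    apply: (translate_disjoint Ggrp disj Gg ns Fz); apply: Freg_Delta.
    by apply: sub; exists z.
  rewrite ea mul_scalar_mx; apply: Freg_scale => //.
  apply: contraTneq (Gunit g Gg) => a0.
  by rewrite ea a0 unitmxE det_scalar expr0n unitr0.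
- move=> g Gg ns; apply/seteqP; split=> // _ [[z Fz <-] Fgz].
  exact: (translate_disjoint Ggrp disj Gg ns Fz (Freg_Delta Fgz)).
- move=> z Oz; have [g Gg Fgz] := orbit_meets_Fbar Ggrp r0 disj Gclub Gspade Oz.
  by exists g => //; split=> //; exact: Omega_mul.
move=> z w g [Oz Fz] [Ow Fw] Gg ns ew; split; split=> //; split=> // FF.
  apply: (translate_disjoint Ggrp disj Gg ns FF); rewrite -ew.
  exact: Fbar_Delta.
have Gi : G (invmx g) by case: Ggrp => _ _ _ + _; apply.
have nsi : ~ is_scalar (invmx g) by move/(is_scalarV (Gunit g Gg)).
apply: (translate_disjoint Ggrp disj Gi nsi FF).
by rewrite ew mulKmx ?Gunit //; exact: Fbar_Delta.
Qed.
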